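(* Let $k\geq 1$ be an integer and let $G$ be a graph of order $n$. If either (a) $\rho(G)\geq\rho(L_{n,k})$ and $n\geq \max\{6k+11,\frac{(k+3)(k+4)}{2}\}$, or (b) $q(G)\geq q(L_{n,k})$ and $n\geq \max\{6k+11,k^2+2k+3\}$, then $G$ contains a cycle $C_{\ell}$ for each $\ell\in [3,n-k+1]$, unless $G\cong L_{n,k}$.
   Context: $\rho(G)$ is the spectral radius (largest eigenvalue) of the adjacency matrix $A(G)$; $q(G)$ is the signless Laplacian spectral radius, the largest eigenvalue of $Q(G)=A(G)+D(G)$ where $D(G)$ is the diagonal degree matrix. $L_{n,k}:=K_1\vee(K_{n-k-1}+K_k)$, where $+$ denotes disjoint union and $\vee$ denotes join (disjoint union plus all edges between the two parts). *)

(* Defs.v *)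
From HB Require Import structures.
From mathcomp Require Import all_boot all_order all_algebra.
From mathcomp Require Import boolp classical_sets reals.
From mathcomp Require complex.

Set Implicit Arguments.
Unset Strict Implicit.
Unset Printing Implicit Defensive.

Import Order.TTheory GRing.Theory Num.Theory.

Record sgraph := SGraph {
  vertex :> finType;
  adj : rel vertex;
  adj_sym : symmetric adj;
  adj_irr : irreflexive adj }.

Definition sgraph_iso (G H : sgraph) : Prop :=
  exists2 f : G -> H, bijective f & {mono f : x y / adj x y}.

Section GraphOps.

Definition complete_adj n : rel 'I_n := fun i j => i != j.

Lemma complete_sym n : symmetric (@complete_adj n).
Proof. by move=> i j; rewrite /complete_adj eq_sym. Qed.

Lemma complete_irr n : irreflexive (@complete_adj n).
Proof. by move=> i; rewrite /complete_adj eqxx. Qed.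

Definition complete n : sgraph := SGraph (@complete_sym n) (@complete_irr n).

Variables G H : sgraph.

(* Disjoint union for b = false, join for b = true. *)
Definition sum_adj (b : bool) : rel (G + H)%type := fun x y =>
  match x, y with
  | inl u, inl v => adj u v
  | inr u, inr v => adj u v
  | _, _ => b
  end.

Lemma sum_adj_sym b : symmetric (sum_adj b).
Proof. by case=> [u|u] [v|v] //=; apply: adj_sym. Qed.

Lemma sum_adj_irr b : irreflexive (sum_adj b).
Proof. by case=> u /=; apply: adj_irr. Qed.

Definition disjoint_union : sgraph :=
  SGraph (@sum_adj_sym false) (@sum_adj_irr false).

Definition join : sgraph := SGraph (@sum_adj_sym true) (@sum_adj_irr true).

End GraphOps.

Definition Lgraph (n k : nat) : sgraph :=
  join (complete 1) (disjoint_union (complete (n - k - 1)) (complete k)).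

Lemma card_Lgraph n k : k < n -> #|Lgraph n k| = n.
Proof.
by move=> kn; rewrite !card_sum !card_ord -subnDA addn1 addnA add1n
  -subSn // subSS subnK // ltnW.
Qed.

(* Meaningful for l >= 3 only: for l = 2 an edge qualifies, traversed twice. *)
Definition has_cycle (G : sgraph) (l : nat) : Prop :=
  exists2 s : seq G, ucycle (@adj G) s & size s = l.

Definition degree (G : sgraph) (x : G) : nat := #|[set y | adj x y]|.

Local Open Scope ring_scope.

Section Spectra.
Variable R : realType.

(* The set of eigenvalues is finite, and nonempty for a symmetric matrix of
   positive size, so that this supremum is a maximum: see
   [max_eigenvalueP]. *)
Definition max_eigenvalue m (M : 'M[R]_m) : R :=
  sup [set a | eigenvalue M a]%classic.

Definition adjacency_mx (G : sgraph) : 'M[R]_#|G| :=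
  \matrix_(i, j) (adj (enum_val i) (enum_val j))%:R.

Definition degree_mx (G : sgraph) : 'M[R]_#|G| :=
  diag_mx (\row_i (degree (enum_val i))%:R).

Definition signless_laplacian (G : sgraph) : 'M[R]_#|G| :=
  adjacency_mx G + degree_mx G.

Definition spectral_radius (G : sgraph) : R :=
  max_eigenvalue (adjacency_mx G).

Definition signless_spectral_radius (G : sgraph) : R :=
  max_eigenvalue (signless_laplacian G).

Section MaxEigenvalue.
Import complex.

Lemma sym_has_eigenvalue m (M : 'M[R]_m) :
  (0 < m)%N -> M^T = M -> exists a, eigenvalue M a.
Proof.
case: m M => // m M _ Msym.
pose f := real_complex R; pose N := map_mx f M.
have Nh : N \is hermsymmx.
  apply: realsym_hermsym.
    apply/is_hermitianmxP; rewrite expr0 scale1r map_mx_id //.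
    by apply/matrixP => i j; rewrite !mxE -{1}Msym mxE.
  apply/mxOverP => i j; rewrite mxE; apply/complex_realP; by exists (M i j).
have := hermitian_spectral_diag_real Nh.
have /orthomx_spectralP := hermitian_normalmx Nh.
set P := spectralmx N; set d := spectral_diag N => defN dR.
have Pu : P \in unitmx by apply: spectral_unit.
exists (Re (d 0 0)).
rewrite -(eigenvalue_map f) /f /=.
rewrite RRe_real; last by move/mxOverP: dR; apply.
apply/eigenvalueP; exists (row 0 P).
  rewrite -/N {1}defN !mulmxA -row_mul mulmxV // -row_mul mul1mx.
  by rewrite row_diag_mx -scalemxAl -rowE.
apply/eqP => P0; move: Pu; rewrite -row_free_unit => /row_freeP[B PB].
have := congr1 (fun X => row 0 X 0 0) PB.
by rewrite row_mul P0 mul0mx !mxE eqxx => /eqP; rewrite eq_sym oner_eq0.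
Qed.

End MaxEigenvalue.

Lemma max_eigenvalueP m (M : 'M[R]_m) : (0 < m)%N -> M^T = M ->
  eigenvalue M (max_eigenvalue M) /\
  forall a, eigenvalue M a -> a <= max_eigenvalue M.
Proof.
move=> m0 Msym; have [a0 a0P] := sym_has_eigenvalue m0 Msym.
have chi0 : char_poly M != 0 by rewrite monic_neq0 ?char_poly_monic.
suff [b bP bmax] : exists2 b, eigenvalue M b &
    forall a, eigenvalue M a -> a <= b.
  suff -> : max_eigenvalue M = b by [].
  apply/eqP; rewrite eq_le; apply/andP; split.
    by apply: ge_sup => //; exists a0.
  by apply: ub_le_sup => //; exists b.
apply: contrapT => noMax.
have step a : eigenvalue M a -> exists2 b, eigenvalue M b & a < b.
  move=> aP; apply: contrapT => nb; apply: noMax; exists a => // c cP.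
  by rewrite leNgt; apply/negP => ac; apply: nb; exists c.
have chain q : exists s, [/\ size s = q.+1, all (eigenvalue M) s
    & sorted >%R s].
  elim: q => [|q [[|x s] [sz al so]]] //.
    by exists [:: a0]; rewrite /= a0P.
  have /step[b bP xb] : eigenvalue M x by case/andP: al.
  by exists (b :: x :: s); split; rewrite /= ?xb ?bP //; case: sz => ->.
have [s [sz al so]] := chain (size (char_poly M)).
have su : uniq s by apply: sorted_uniq so; [exact: rev_trans lt_trans | exact: ltxx].
have : (size s < size (char_poly M))%N.
  apply: max_poly_roots => //; apply/allP => x /(allP al).
  by rewrite eigenvalue_root_char.
by rewrite sz ltnNge leqnSn.
Qed.

Lemma adjacency_mx_sym (G : sgraph) : (adjacency_mx G)^T = adjacency_mx G.
Proof. by apply/matrixP=> i j; rewrite !mxE adj_sym. Qed.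

Lemma signless_laplacian_sym (G : sgraph) :
  (signless_laplacian G)^T = signless_laplacian G.
Proof.
by rewrite /signless_laplacian linearD /= adjacency_mx_sym /degree_mx tr_diag_mx.
Qed.

End Spectra.

(* Main.v *)
Require Import Defs.
From mathcomp Require Import all_boot all_order all_algebra reals.
From mathcomp Require Import zify ring lra.
From mathcomp Require complex.

Set Implicit Arguments.
Unset Strict Implicit.
Unset Printing Implicit Defensive.

Import Order.TTheory GRing.Theory Num.Theory.

(* A lower bound on either spectral radius forces few nonadjacent pairs: for the
   adjacency matrix by rho^2 <= 2 e (n - 1) / n, for the signless Laplacian by
   q <= 2 e / (n - 1) + n - 2, against rho >= n - k - 1 and q > 2 (n - k - 1), which
   hold for L_{n,k} because it contains K_{n-k}.

   Among the sets of n - k + 1 vertices let W span the most edges. If W satisfies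
   Posa's degree condition, it has a spanning cycle, and by Bondy's argument cycles of
   all shorter lengths. Otherwise some i < |W| / 2 has i vertices of degree at most i
   in W; as W is extremal, every vertex outside W then has at most i + 1 neighbours
   in W. For i >= 2 this gives too many nonadjacent pairs. For i = 1, removing the
   vertex of degree at most 1 leaves a set H of n - k vertices such that every vertex
   outside H has at most one neighbour in H.

   In that case let y be the absolute value of a top eigenvector of G and a the
   vertex of H where y is largest. Completing H and its complement to cliques and
   moving all edges between them to a turns G into L_{n,k} without decreasing the
   quadratic form at y. The spectral hypothesis forces equality, so y is an
   eigenvector of L_{n,k}, hence positive, so H and its complement are cliques and
   each outer vertex has exactly one neighbour in H. If these neighbours agree, G is
   L_{n,k}; if not, two outer vertices give a detour through two vertices of H and
   all cycle lengths appear. *)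

(** * Spanning cycles and pancyclicity *)

Section Cycles.
Variable T : finType.
Implicit Types (e : rel T) (W X Y : {set T}).

Definition deg_in e W x := #|[set y in W | e x y]|.

Definition spanning_cycle e W := exists2 s, ucycle e s & s =i W.

Lemma complete_cycle e (s : seq T) : 1 < size s -> uniq s ->
  {in s &, forall x y, x != y -> e x y} -> cycle e s.
Proof.
case: s => [|x [|y s]] // _ us es /=.
have pw : pairwise e [:: x, y & s].
  move: us; rewrite uniq_pairwise; apply: (@sub_in_pairwise _ (mem [:: x, y & s])).
    by move=> a b ai bi /= ab; apply: es.
  by apply/allP.
have /= /andP[-> /=] := pairwise_sorted pw.
rewrite rcons_path => -> /=; apply: es.
- by rewrite inE mem_last orbT.
- by rewrite inE eqxx.
by move/andP: us => [+ _]; apply: contraNneq => <-; rewrite mem_last.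
Qed.

(* The added edge, if used, is opened to give a spanning path from u to v. *)
Lemma spanning_cycle_add_edge e W u v : symmetric e ->
    u != v -> 2 < #|W| ->
    spanning_cycle (fun x y => e x y || (x == u) && (y == v) || (x == v) && (y == u)) W ->
  spanning_cycle e W \/
  exists q, [/\ uniq (u :: q), path e u q, last u q = v & u :: q =i W].
Proof.
move=> esym uv W3 [s /andP[cs us] sW].
set e' := (fun x y => _) in cs.
have sz : 2 < size s by rewrite -(card_uniqP us) (eq_card sW).
have [usi|uns] := boolP (u \in s); last first.
  left; exists s => //; rewrite /ucycle us andbT.
  suff ee' : {in s &, e' =2 e} by rewrite -(eq_in_cycle ee' (allss s)).
  move=> x y xs ys; rewrite /e'.
  case: (x =P u) => [xu|_]; first by rewrite -xu xs in uns.
  case: (y =P u) => [yu|_]; first by rewrite -yu ys in uns.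
  by rewrite andbF !orbF.
have [i q qE] := rot_to usi.
have uq : uniq (u :: q) by rewrite -qE rot_uniq.
have qW : u :: q =i W by move=> x; rewrite -qE mem_rot sW.
have szq : 1 < size q by rewrite -ltnS -[(size q).+1]/(size (u :: q)) -qE size_rot.
have cq : cycle e' (u :: q) by rewrite -qE rot_cycle.
have uNq : u \notin q by case/andP: uq.
have ee' : {in q &, e' =2 e}.
  move=> x y xq yq; rewrite /e'.
  case: (x =P u) => [xu|_]; first by rewrite -xu xq in uNq.
  case: (y =P u) => [yu|_]; first by rewrite -yu yq in uNq.
  by rewrite andbF !orbF.
case: q => [|x q] // in qE uq qW szq cq uNq ee' *.
move: cq => /= /andP[ux]; rewrite rcons_path => /andP[xq qu].
have {}xq : path e x q.
  have := @eq_in_path _ (mem (x :: q)) e' e ee' x q.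
  by rewrite xq => <- //; apply/allP.
have lq : last x q \in q by case: (q) szq => //= a b _; apply: mem_last.
have xNl : x != last x q.
  by apply: contraTneq lq => <-; move: uq => /and3P[].
(* The added edge can only be used at [u]: as the first edge, as the closing edge, or not at all. In
   the first case the path is read backwards. *)
have [xv|xv] := eqVneq x v.
  right; exists (rev (v :: q)); rewrite -xv.
  have qu' : e (last x q) u.
    by move: qu; rewrite /e' (negPf uv) andbF orbF -xv [_ == x]eq_sym (negPf xNl) orbF.
  split.
  - by rewrite /= mem_rev rev_uniq.
  - have := rev_path e x (rcons q u); rewrite last_rcons belast_rcons => ->.
    by rewrite (eq_path (e' := e)) ?rcons_path ?xq // => a b; rewrite esym.
  - by rewrite rev_cons last_rcons.
  - by move=> z; rewrite -qW !inE mem_rev inE.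
have ux' : e u x by move: ux; rewrite /e' (negPf xv) (negPf uv) andbF !orbF.
have [lv|lv] := eqVneq (last x q) v.
  by right; exists (x :: q); split => //=; rewrite ?ux'.
left; exists (u :: x :: q) => //; rewrite /ucycle uq andbT /= ux' rcons_path xq /=.
by move: qu; rewrite /e' (negPf lv) (negPf uv) andbF !orbF.
Qed.

(** Cuts the path right after [x]. The last vertex is excluded because [next] wraps around to [u]
    there. *)
Lemma next_split (u x : T) q : uniq (u :: q) -> x \in u :: q -> x != last u q ->
  exists q1 q2, q = q1 ++ next (u :: q) x :: q2 /\ last u q1 = x.
Proof.
move=> uq xi xl; set i := index x (u :: q).
have iq : i < size q.
  have : i < (size q).+1 by move: xi; rewrite -index_mem.
  rewrite ltnS leq_eqVlt => /orP[/eqP iE|//].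
  by move: xl; rewrite (last_nth u) -iE nth_index ?eqxx.
exists (take i q), (drop i.+1 q).
rewrite next_nth xi -drop_nth // cat_take_drop; split=> //.
by rewrite (last_nth u) size_takel 1?ltnW // -[u :: take i q]/(take i.+1 (u :: q))
  nth_take // nth_index.
Qed.

(** Follow [q1], jump along the chord to the end of [q2], run [q2] backwards to [y] and return to
    [u]. *)
Lemma crossing_cycle e u y q1 q2 : symmetric e ->
    path e u q1 -> path e y q2 -> e u y -> e (last y q2) (last u q1) ->
  cycle e (u :: q1 ++ rev (y :: q2)).
Proof.
move=> esym p1 p2 uy cr /=.
rewrite rcons_cat cat_path p1 /= -rev_cons.
have := rev_path e u (rcons (y :: q2) (last u q1)).
rewrite last_rcons belast_rcons => ->.
by rewrite (eq_path (e' := e)) ?rcons_path /= ?uy ?p2 // => a b; rewrite esym.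
Qed.

Lemma deg_in_sub e e' W x : subrel e e' -> deg_in e W x <= deg_in e' W x.
Proof.
by move=> ee; apply/subset_leq_card/subsetP => y; rewrite !inE => /andP[-> /ee].
Qed.

(** [P] holds the vertices whose successor on the path is a neighbour of [u]. If [v] is adjacent to
    one of them, crossing chords close a cycle. Otherwise [P] is disjoint from the neighbourhood of
    [v] and both lie in [W] without [v], so i = deg u satisfies 2i < |W|, and the i elements of [P]
    have degree at most i by maximality. *)
Lemma posa_step e W u v q : symmetric e -> irreflexive e ->
    uniq (u :: q) -> path e u q -> last u q = v -> u :: q =i W -> 0 < size q ->
    (forall x, x \in W -> x != v -> ~~ e x v ->
        deg_in e W x <= deg_in e W u) ->
    deg_in e W u <= deg_in e W v ->
  spanning_cycle e W \/
  exists i, [/\ 0 < i, i.*2 < #|W| & i <= #|[set x in W | deg_in e W x <= i]|].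
Proof.
move=> esym eirr uq pq lq qW q0 maxd duv.
pose P := [set x in W | e u (next (u :: q) x)].
have vW : v \in W by rewrite -qW -lq mem_last.
have PE : #|P| = deg_in e W u.
  rewrite -(card_imset P (can_inj (prev_next uq))); apply: eq_card => y.
  apply/imsetP/idP => [[x]|].
    by rewrite !inE => /andP[xW ux] ->; rewrite -qW mem_next qW xW.
  rewrite inE => /andP[yW uy]; exists (prev (u :: q) y); last by rewrite next_prev.
  by rewrite inE -qW mem_prev qW yW next_prev.
(* The successor of the last vertex [v] is [u], which is not adjacent to itself. *)
have vP : v \notin P.
  rewrite inE vW andTb -lq next_nth mem_last.
  have -> : index (last u q) (u :: q) = size q by rewrite (last_nth u) index_uniq.
  by rewrite nth_default // eirr.
have [/existsP[x /andP[xP vx]]|noX] := boolP [exists x, (x \in P) && e v x].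
  left; have xNv : x != last u q by rewrite lq; apply: contraNneq vP => <-.
  move: xP; rewrite inE => /andP[]; rewrite -qW => xq ux.
  have [q1 [q2 []]] := next_split uq xq xNv.
  move: (next (u :: q) x) ux => y uy qE lx.
  have ly : last y q2 = v by rewrite -lq qE last_cat.
  exists (u :: q1 ++ rev (y :: q2)).
    move: pq; rewrite qE cat_path /= => /and3P[pq1 _ pq2].
    rewrite /ucycle crossing_cycle ?ly ?lx //.
    by move: uq; rewrite qE !cons_uniq !mem_cat mem_rev !cat_uniq rev_uniq has_rev.
  by move=> z; rewrite -qW qE !inE !mem_cat mem_rev.
right; exists (deg_in e W u).
have Pnv x : x \in P -> ~~ e v x.
  by move=> xP; apply: contraNN noX => vx; apply/existsP; exists x; rewrite xP.
split.
- apply/card_gt0P; case: q q0 pq qW {uq lq P PE vP noX Pnv} => //= y q _ /andP[uy _] qW.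
  by exists y; rewrite inE uy -qW !inE eqxx orbT.
- suff : deg_in e W u + deg_in e W v < #|W| by lia.
  rewrite -PE -ltnS (cardsD1 v W) vW add1n !ltnS /deg_in.
  rewrite -cardsUI (_ : _ :&: _ = set0) ?cards0 ?addn0.
    apply/subset_leq_card/subsetP => x; rewrite !inE.
    have [->|_ /orP[]/andP[]//] := eqVneq x v.
    by move: vP; rewrite inE => /negPf ->; rewrite eirr andbF.
  apply/setP => x; rewrite in_set0 inE [x \in [set _ in _ | _]]inE.
  by apply/negP => /andP[/Pnv /negPf ->]; rewrite andbF.
- rewrite -{1}PE; apply/subset_leq_card/subsetP => x xP.
  have xW : x \in W by move: xP; rewrite inE => /andP[].
  rewrite inE xW /=; apply: maxd => //; last by rewrite esym Pnv.
  by apply: contraNneq vP => <-.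
Qed.

(* Posa's theorem, by closing an edge-maximal counterexample: the new edge uv is
   chosen with maximal degree sum. *)
Lemma posa e W : symmetric e -> irreflexive e -> 2 < #|W| ->
  spanning_cycle e W \/
  exists i, [/\ 0 < i, i.*2 < #|W| & i <= #|[set x in W | deg_in e W x <= i]|].
Proof.
pose ne e := [set p : T * T | [&& p.1 \in W, p.2 \in W, p.1 != p.2 & ~~ e p.1 p.2]].
have [N] := ubnP #|ne e|; elim: N e => // N IH e neN esym eirr W3.
have [/eqP ne0|] := boolP (ne e == set0).
  left; exists (enum W); last exact: mem_enum.
  rewrite /ucycle enum_uniq andbT; apply: complete_cycle.
  - by rewrite -cardE; lia.
  - exact: enum_uniq.
  move=> x y; rewrite !mem_enum => xW yW xy.
  by have := in_set0 (x, y); rewrite -ne0 inE /= xW yW xy /= => /negPn.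
case/set0Pn => p0 p0i.
pose ds p := deg_in e W p.1 + deg_in e W p.2.
have [[u0 v0] p1i p1max] := @arg_maxnP _ p0 (mem (ne e)) ds p0i.
have [u [v [uvi uvmax duv]]] : exists u v, [/\ (u, v) \in ne e,
    forall p, p \in ne e -> ds p <= ds (u, v) & deg_in e W u <= deg_in e W v].
  have [le|/ltnW le] := leqP (deg_in e W u0) (deg_in e W v0); first by exists u0, v0.
  exists v0, u0; split=> //.
    by move: p1i; rewrite /= !inE /= eq_sym esym => /and4P[-> -> -> ->].
  by move=> p /p1max /leq_trans; apply; rewrite /ds /= addnC.
have {p0 p0i u0 v0 p1i p1max}/and4P[uW vW uv nuv] :
  [&& u \in W, v \in W, u != v & ~~ e u v] by move: uvi; rewrite inE.
pose e' x y := e x y || (x == u) && (y == v) || (x == v) && (y == u).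
have ee' : subrel e e' by move=> x y exy; rewrite /e' exy.
have e'sym : symmetric e'.
  by move=> x y; rewrite /e' esym -!orbA [X in _ || X]orbC; congr [|| _, _ | _]; rewrite andbC.
have e'irr : irreflexive e'.
  move=> x; rewrite /e' eirr /=; have [->|] := eqVneq x u; last by rewrite andbF.
  by rewrite (negPf uv).
have ne' : #|ne e'| < N.
  rewrite -ltnS; apply: leq_trans neN; rewrite ltnS; apply/proper_card/properP; split.
    by apply/subsetP => p; rewrite !inE => /and4P[-> -> -> /=]; apply/contraNN/ee'.
  by exists (u, v) => //; rewrite inE /= /e' !eqxx !orbT !andbF.
(* Degrees only grow with the added edge, so a witness [i] for [e'] also serves for [e]. *)
have [hc|[i [i0 i2 iA]]] := IH e' ne' e'sym e'irr W3; last first.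
  right; exists i; split=> //; apply: leq_trans iA _.
  apply/subset_leq_card/subsetP => x; rewrite !inE => /andP[-> /=].
  exact/leq_trans/deg_in_sub.
have [?|[q [uq pq lq qW]]] := spanning_cycle_add_edge esym uv W3 hc; first by left.
apply: (posa_step esym eirr uq pq lq qW _ _ duv).
  by case: (q) lq => //= /eqP; rewrite (negPf uv).
(* The pairs [(x, v)] and [(u, v)] share [v], so the maximal degree sum bounds the degree of [x] by
   that of [u]. *)
move=> x xW xv nxv; rewrite -(leq_add2r (deg_in e W v)).
by apply: (uvmax (x, v)); rewrite inE /= xW vW xv nxv.
Qed.

(** The cycle is x, r_i, ..., r_j, z, closed by the edge from [z] to [x]; it is a triangle when i =
    j. *)
Lemma short_chords_cycle e (x z : T) r i j : uniq (x :: rcons r z) ->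
  path e x (rcons r z) -> e z x -> i <= j < size r ->
  e x (nth x r i) -> e z (nth x r j) -> symmetric e ->
  exists2 s, ucycle e s & size s = j - i + 3.
Proof.
move=> us ps zx /andP[ij jr] xi zj esym.
have ir := leq_ltn_trans ij jr.
pose sl := take (j - i) (drop i.+1 r).
have szl : size sl = j - i by rewrite size_takel // size_drop; lia.
have rE : r = take i r ++ nth x r i :: sl ++ drop (j - i) (drop i.+1 r).
  by rewrite cat_take_drop -drop_nth // cat_take_drop.
have lsl : last (nth x r i) sl = nth x r j.
  rewrite (last_nth x) szl.
  have -> : nth x r j = nth x (nth x r i :: drop i.+1 r) (j - i).
    by rewrite -drop_nth // nth_drop subnKC.
  by rewrite -[_ :: sl]/(take (j - i).+1 (nth x r i :: drop i.+1 r)) nth_take.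
exists (x :: nth x r i :: rcons sl z); last by rewrite /= size_rcons szl; lia.
apply/andP; split.
  rewrite /= xi !rcons_path last_rcons lsl zx andbT [e _ z]esym zj andbT.
  move: ps; rewrite rcons_path {1}rE cat_path /= => /andP[/and3P[_ _]].
  by rewrite cat_path => /andP[].
apply: subseq_uniq us; rewrite /= eqxx {2}rE rcons_cat.
rewrite -[X in subseq X _]cat0s; apply: cat_subseq; first exact: sub0seq.
rewrite /= eqxx rcons_cat -cats1; apply: cat_subseq => //.
by rewrite sub1seq mem_rcons mem_head.
Qed.

(** The chords cross: the cycle is x, r_0, ..., r_j, z, then r backwards from its end to r_i, and
    back to [x]. *)
Lemma long_chords_cycle e (x z : T) r i j : uniq (x :: rcons r z) ->
  path e x (rcons r z) -> j < i < size r ->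
  e x (nth x r i) -> e z (nth x r j) -> symmetric e ->
  exists2 s, ucycle e s & size s = j + size r - i + 3.
Proof.
move=> us ps /andP[ji ir] xi zj esym.
have jr := ltn_trans ji ir.
have qE : rcons (drop i r) z = nth x r i :: rcons (drop i.+1 r) z.
  by rewrite (drop_nth x).
exists (x :: take j.+1 r ++ rev (rcons (drop i r) z)); last first.
  by rewrite /= size_cat size_rev size_rcons size_takel // size_drop; lia.
have rE : rcons r z = take j.+1 r ++ rcons (drop j.+1 r) z.
  by rewrite -rcons_cat cat_take_drop.
have dE : drop i r = drop (i - j.+1) (drop j.+1 r) by rewrite drop_drop subnK.
apply/andP; split.
  rewrite qE crossing_cycle //.
  - by move: ps; rewrite rE cat_path => /andP[].
  - move: ps; rewrite -{1}(cat_take_drop i r) rcons_cat cat_path qE /=.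
    by case/and3P.
  - by rewrite last_rcons (last_nth x) size_takel // -[x :: _]/(take j.+2 (x :: r))
      nth_take.
rewrite -(perm_uniq (s1 := x :: take j.+1 r ++ rcons (drop i r) z)); last first.
  by rewrite perm_cons perm_cat2l perm_sym perm_rev.
apply: subseq_uniq us; rewrite /= eqxx rE; apply: cat_subseq => //.
rewrite -!cats1; apply: cat_subseq => //; rewrite dE; exact: drop_subseq.
Qed.

(* Bondy's argument: two consecutive vertices of the spanning cycle have degree
   sum larger than its length, so their neighbourhoods meet after a rotation of
   the remaining positions. *)
Lemma pancyclic e W l : symmetric e -> irreflexive e -> spanning_cycle e W ->
  #|W| ^ 2 < 2 * \sum_(x in W) deg_in e W x -> 3 <= l <= #|W| ->
  exists2 s, ucycle e s & size s = l.
Proof.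
move=> esym eirr [s /andP[cs us] sW] big lW.
(* Averaging: summed over the cycle, the degree of a vertex plus that of its predecessor gives twice
   the degree sum. *)
have [x xW xbig] : exists2 x, x \in W & #|W| < deg_in e W x + deg_in e W (prev s x).
  apply/exists_inP; apply: contraLR big; rewrite negb_exists_in => /forall_inP small.
  have -> : 2 * \sum_(x in W) deg_in e W x =
      \sum_(x in W) (deg_in e W x + deg_in e W (prev s x)).
    rewrite big_split mul2n -addnn; congr (_ + _).
    rewrite (reindex_inj (can_inj (next_prev us))) /=.
    by apply: eq_bigl => x; rewrite -!sW mem_prev.
  rewrite -leqNgt -mulnn -sum_nat_const; apply: leq_sum => x /small.
  by rewrite -leqNgt.
have sz : size s = #|W| by rewrite -(card_uniqP us) (eq_card sW).
have [i0 q qE] := rot_to (etrans (sW x) xW).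
have uq : uniq (x :: q) by rewrite -qE rot_uniq.
have szq : size q = #|W|.-1 by rewrite -sz -(size_rot i0 s) qE.
have pE : prev s x = last x q.
  rewrite -(prev_rot i0 us) qE prev_nth mem_head.
  rewrite (_ : index x q = size q) -?last_nth //.
  by apply/eqP; rewrite eqn_leq index_size leqNgt index_mem; case/andP: uq.
have cq : cycle e (x :: q) by rewrite -qE rot_cycle.
have qW : x :: q =i W by move=> y; rewrite -qE mem_rot sW.
case/lastP: q => [|r z] in qE uq szq pE cq qW *; first by move: szq => /=; lia.
rewrite pE last_rcons in xbig; rewrite size_rcons in szq.
move: cq => /=; rewrite rcons_path last_rcons => /andP[pr zx].
set p := size r in szq.
pose c := l - 3.
have cp : c < p by rewrite /c; lia.
(* Cyclic shift by c = l - 3 on the [p] positions. A chord from [z] to position [j] and one from [x]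
   to position [f j] yield a cycle of length c + 3 = l, with short chords when c <= j and long ones
   otherwise. *)
pose f j := if c <= j then j - c else j + p - c.
pose A := [set j : 'I_p | e z (nth x r j)].
pose B := [set j : 'I_p | e x (nth x r (f j))].
have inW y : y \in W -> [\/ y = x, y = z | exists2 j : 'I_p, nth x r j = y & true].
  rewrite -qW inE mem_rcons inE => /or3P[/eqP|/eqP|yr]; [by constructor 1|by constructor 2|].
  constructor 3; have jp : index y r < p by rewrite index_mem.
  by exists (Ordinal jp) => //=; rewrite nth_index.
have leA : deg_in e W z <= #|A|.+1.
  apply: leq_trans (_ : #|x |: [set nth x r (j : 'I_p) | j in A]| <= _).
    apply/subset_leq_card/subsetP => y; rewrite !inE => /andP[/inW[->|->|[j <- _]]].
    - by rewrite eqxx.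
    - by rewrite eirr.
    by move=> zj; apply/orP; right; apply/imsetP; exists j; rewrite ?inE.
  by apply: leq_trans (leq_card_setU _ _) _; rewrite cards1 add1n ltnS leq_imset_card.
have leB : deg_in e W x <= #|B|.+1.
  apply: leq_trans (_ : #|z |: [set nth x r (f (j : 'I_p)) | j in B]| <= _).
    apply/subset_leq_card/subsetP => y; rewrite !inE => /andP[/inW[->|->|[i <- _]]].
    - by rewrite eirr.
    - by rewrite eqxx.
    move=> xi; apply/orP; right; apply/imsetP.
    have jp : (if i + c < p then i + c else i + c - p) < p.
      by have := ltn_ord i; case: ifP; lia.
    have fj : f (Ordinal jp) = i.
      by rewrite /f /=; have := ltn_ord i; case: (ltnP (i + c) p); case: ifP; lia.
    by exists (Ordinal jp); rewrite ?inE fj.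
  by apply: leq_trans (leq_card_setU _ _) _; rewrite cards1 add1n ltnS leq_imset_card.
(* There are p = |W| - 2 positions, while |A| + |B| >= deg z + deg x - 2 > |W| - 2. *)
have /set0Pn[j] : A :&: B != set0.
  rewrite -card_gt0; have := cardsUI A B; have := max_card (A :|: B).
  by rewrite card_ord; lia.
rewrite !inE => /andP[zj]; rewrite /f.
have jp := ltn_ord j; case: leqP => cj xj.
  have [|t ut st] := short_chords_cycle uq pr zx _ xj zj esym; first by rewrite -/p; lia.
  by exists t => //; rewrite st; rewrite /c in cj *; lia.
have [|t ut st] := long_chords_cycle uq pr _ xj zj esym; first by rewrite -/p; lia.
by exists t => //; rewrite st -/p; rewrite /c in cj *; lia.
Qed.

End Cycles.

(** * Extremal sets and nonadjacent pairs *)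

Section DensePairs.
Variable T : finType.
Implicit Types (r e : rel T) (A W X Y : {set T}).

(** Ordered pairs are counted, so [pairs e X X] is twice the number of edges inside [X] when [e] is
    symmetric. *)
Definition pairs r X Y : nat := \sum_(x in X) \sum_(y in Y) r x y.

Lemma pairsC r X Y : symmetric r -> pairs r X Y = pairs r Y X.
Proof.
move=> rsym; rewrite /pairs exchange_big /=.
by apply: eq_bigr => x _; apply: eq_bigr => y _; rewrite rsym.
Qed.

Lemma pairs_setIDr r X A W : A \subset W ->
  pairs r X W = pairs r X A + pairs r X (W :\: A).
Proof.
move=> AW; rewrite /pairs -big_split; apply: eq_bigr => x _ /=.
by rewrite (big_setID A) /= (setIidPr AW).
Qed.

Lemma pairs_setID r A W : symmetric r -> A \subset W ->
  pairs r W W = pairs r A A + 2 * pairs r A (W :\: A) + pairs r (W :\: A) (W :\: A).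
Proof.
move=> rsym AW; rewrite (pairs_setIDr r W AW) !(pairsC W) // !(pairs_setIDr r _ AW).
by rewrite (pairsC (W :\: A) A) // mul2n -addnn !addnA.
Qed.

Lemma pairs_ge r X Y d : {in X, forall x, d <= \sum_(y in Y) r x y} ->
  #|X| * d <= pairs r X Y.
Proof. by move=> h; rewrite -sum_nat_const; apply: leq_sum. Qed.

Lemma pairs_self_le r A : irreflexive r -> pairs r A A <= #|A| * #|A|.-1.
Proof.
move=> rirr; rewrite -sum_nat_const; apply: leq_sum => x xA.
rewrite (big_setD1 x) //= rirr add0n (cardsD1 x) xA add1n /= -sum1_card.
by apply: leq_sum => y _; case: (r x y).
Qed.

Lemma deg_inE e W x : deg_in e W x = \sum_(y in W) e x y.
Proof.
rewrite /deg_in -sum1_card big_mkcond [RHS]big_mkcond; apply: eq_bigr => y _.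
by rewrite inE; case: (y \in W); case: (e x y).
Qed.

Definition nonadj e : rel T := fun x y => (x != y) && ~~ e x y.

Lemma nonadj_sym e : symmetric e -> symmetric (nonadj e).
Proof. by move=> esym x y; rewrite /nonadj eq_sym esym. Qed.

Lemma nonadj_irr e : irreflexive (nonadj e).
Proof. by move=> x; rewrite /nonadj eqxx. Qed.

Lemma deg_in_nonadj e W x : irreflexive e ->
  deg_in e W x + \sum_(y in W) nonadj e x y + (x \in W) = #|W|.
Proof.
move=> eirr; rewrite deg_inE -sum1_card.
have -> : (x \in W : nat) = \sum_(y in W) (y == x).
  have [xW|xW] := boolP (x \in W).
    by rewrite (big_setD1 x) //= eqxx big1 // => y; rewrite !inE => /andP[/negPf->].
  by rewrite big1 // => y yW; case: eqP => // yx; rewrite -yx yW in xW.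
rewrite -!big_split; apply: eq_bigr => y _ /=; rewrite /nonadj eq_sym.
by have [->|] := eqVneq y x; rewrite ?eirr //=; case: (e x y).
Qed.

Lemma sum_deg_in e W : irreflexive e ->
  \sum_(x in W) deg_in e W x + pairs (nonadj e) W W + #|W| = #|W| * #|W|.
Proof.
move=> eirr; rewrite -[X in _ + X = _]sum1_card /pairs -!big_split -sum_nat_const /=.
by apply: eq_bigr => x xW; rewrite -(deg_in_nonadj W x eirr) xW.
Qed.

(** Both sets contain [W :\ a], so their edge counts differ only by the degrees of [s] and [a] into
    it. *)
Lemma exchange_deg e W a s : symmetric e -> irreflexive e ->
    a \in W -> s \notin W ->
    pairs e (s |: (W :\ a)) (s |: (W :\ a)) <= pairs e W W ->
  deg_in e (W :\ a) s <= deg_in e (W :\ a) a.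
Proof.
move=> esym eirr aW sW.
have aux x X : x \notin X ->
    pairs e (x |: X) (x |: X) = 2 * deg_in e X x + pairs e X X.
  move=> xX; rewrite (@pairs_setID e [set x]) ?subsetUl // setU1K //.
  by rewrite {1 2}/pairs !big_set1 /= eirr add0n deg_inE.
have := aux a (W :\ a); rewrite setD1K // => ->; last by rewrite setD11.
by rewrite aux ?leq_add2r ?leq_mul2l // inE (negPf sW) andbF.
Qed.

Lemma subset_of_card A i : i <= #|A| -> exists2 B : {set T}, B \subset A & #|B| = i.
Proof.
case/card_geqP => s [us <- sA]; exists [set x in s]; last by rewrite cardsE; apply/card_uniqP.
by apply/subsetP => x; rewrite inE => /sA.
Qed.

Lemma deg_inD1 e W a x : a \in W -> deg_in e W x = e x a + deg_in e (W :\ a) x.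
Proof. by move=> aW; rewrite !deg_inE (big_setD1 a). Qed.

(* W maximises the number of edges among the sets of n - k + 1 vertices: a vertex
   of small degree in W then bounds the degrees into W of all vertices outside. *)
Lemma dense_cycles_or_split e n k : symmetric e -> irreflexive e ->
    #|T| = n -> 1 <= k -> 6 * k + 11 <= n ->
    pairs (nonadj e) setT setT + 3 <= 2 * ((k + 1) * (n - k - 2)) ->
  (forall l, 3 <= l <= n - k + 1 -> exists2 s, ucycle e s & size s = l) \/
  exists2 H : {set T}, #|H| = n - k & forall s, s \notin H -> deg_in e H s <= 1.
Proof.
move=> esym eirr Tn k1 nk few.
have [W0 _ W0n] : exists2 W0 : {set T}, W0 \subset setT & #|W0| = n - k + 1.
  by apply: subset_of_card; rewrite cardsT; lia.
have [W /eqP Wn Wmax] := @arg_maxnP _ W0 (fun X : {set T} => #|X| == n - k + 1)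
  (fun X => pairs e X X) (introT eqP W0n).
have nsym := nonadj_sym esym; have nirr := @nonadj_irr e.
have exch a s : a \in W -> s \notin W -> deg_in e (W :\ a) s <= deg_in e (W :\ a) a.
  move=> aW sW; apply: exchange_deg => //; apply: Wmax => /=.
  have := cardsD1 a W; rewrite aW Wn => Wa.
  by rewrite cardsU1 !inE (negPf sW) andbF /= [_ + #|_|]add1n; lia.
have cTW : pairs (nonadj e) setT setT = pairs (nonadj e) (~: W) (~: W) +
    2 * pairs (nonadj e) (~: W) W + pairs (nonadj e) W W.
  by rewrite (@pairs_setID (nonadj e) (~: W)) ?subsetT // setTD setCK.
have W3 : 2 < #|W| by rewrite Wn; lia.
have [hc|[i [i0 i2 iA]]] := posa esym eirr W3.
  left=> l ll; apply: (pancyclic esym eirr hc); last by rewrite Wn.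
  (* Few nonadjacent pairs make [W] dense: its degree sum exceeds half of |W|^2, as Bondy's argument
     requires. *)
  have := sum_deg_in W eirr; rewrite Wn -mulnn.
  set m := n - k + 1; have mk : 5 * k + 12 <= m by lia.
  have nE : n - k - 2 = m - 3 by lia.
  have : pairs (nonadj e) W W + 3 <= 2 * ((k + 1) * (m - 3)) by rewrite -nE; lia.
  by clear - mk k1; nia.
have degA a : a \in [set x in W | deg_in e W x <= i] ->
    a \in W /\ deg_in e (W :\ a) a <= i.
  rewrite inE => /andP[aW]; rewrite (deg_inD1 _ _ aW) eirr add0n; split=> //.
have [i1|i1] := leqP i 1.
  right; have {i0 i1} iE : i = 1 by lia.
  have /card_gt0P[a /degA[aW da]] : 0 < #|[set x in W | deg_in e W x <= i]| by lia.
  exists (W :\ a); first by have := cardsD1 a W; rewrite aW; lia.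
  rewrite iE in da.
  move=> s; rewrite !inE negb_and negbK => /orP[/eqP -> //|sW].
  exact: leq_trans (exch _ _ aW sW) da.
have [A sA cA] := subset_of_card iA.
have AW : A \subset W by apply/subsetP => a /(subsetP sA) /degA[].
have /card_gt0P[a aA] : 0 < #|A| by rewrite cA; lia.
have [aW da] := degA a (subsetP sA _ aA).
have cS : #|~: W| = k - 1 by have := cardsC W; rewrite Wn Tn; lia.
(* An outer vertex has at most i + 1 neighbours in [W], hence at least n - k - i nonneighbours
   there; a vertex of [A] has at most i neighbours and misses as many others. Pairs inside [A] get
   counted twice, which [h3] corrects. *)
have h1 : (k - 1) * (n - k - i) <= pairs (nonadj e) (~: W) W.
  rewrite -cS; apply: pairs_ge => s; rewrite inE => sW.
  have := deg_in_nonadj W s eirr; rewrite (negPf sW) (deg_inD1 _ _ aW) Wn.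
  have := exch _ _ aW sW; case: (e s a); lia.
have h2 : i * (n - k - i) <= pairs (nonadj e) A W.
  rewrite -cA; apply: pairs_ge => x xA.
  have [xW] := degA x (subsetP sA _ xA).
  have := deg_in_nonadj W x eirr; rewrite xW (deg_inD1 _ _ xW) eirr Wn; lia.
have h3 := pairs_self_le A nirr; rewrite cA in h3.
have := pairs_setID nsym AW; have := pairs_setIDr (nonadj e) A AW.
have [t iE] : exists t, i = t + 2 by exists (i - 2); lia.
have [N NE] : exists N, n - k = N by exists (n - k).
rewrite NE in few h1 h2 Wn; rewrite Wn in i2.
have h4 : 5 * k + 11 <= N by lia.
(* Equality holds at i = 2, where the 3 in [few] leaves no slack. *)
have key : 2 * ((k + 1) * (N - 2)) <= 2 * ((k - 1) * (N - i)) + 2 * (i * (N - i)) - i * i.-1 + 2.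
  rewrite iE in i2 *; clear - k1 h4 i2.
  have [K KE] : exists K, k = K.+1 by exists k.-1; lia.
  have [D DE] : exists D, N = D + (2 * t + 4) by exists (N - (2 * t + 4)); lia.
  have -> : (t + 2) * (t + 2).-1 = (t + 2) * (t + 1) by congr (_ * _); lia.
  by rewrite KE DE in h4 *; nia.
by clear - key h1 h2 h3 cTW few; lia.
Qed.

End DensePairs.

(** * Arithmetic: from spectral inequalities to few nonadjacent pairs *)

Lemma nonadj_bound_adjacency n k E M : (E + M + n = n * n -> 6 * k + 11 <= n ->
  (n - k - 1) ^ 2 * n <= E * (n - 1) -> (k + 3) * (k + 4) <= 2 * n ->
  M + 3 <= 2 * ((k + 1) * (n - k - 2)))%N.
Proof.
move=> EM nk h nk3.
(* With n - 1 = q + k, the hypotheses give M <= (q + k + 1)(2qk + k^2) / (q + k) <= 2qk + k^2 + 2k.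
   The target 2(k + 1)(q - 1) - 3 exceeds this once 2n >= (k + 3)(k + 4). *)
have [q qE] : exists q, n = q + k + 1 by exists (n - k - 1); lia.
have e1 : n - k - 1 = q by lia.
have e2 : n - k - 2 = q - 1 by lia.
have e3 : n - 1 = q + k by lia.
rewrite e1 e3 -mulnn in h; rewrite e2; rewrite qE in EM nk nk3 h *.
rewrite leqNgt; apply/negP => big.
have big2 : (2 * ((k + 1) * (q - 1))) * (q + k) <= (M + 2) * (q + k).
  by rewrite leq_mul2r; lia.
have nk4 : ((k + 3) * (k + 4)) * (q + k) <= 2 * (q + k + 1) * (q + k).
  by rewrite leq_mul2r nk3 orbT.
have EM2 : (E + M + (q + k + 1)) * (q + k) = (q + k + 1) * (q + k + 1) * (q + k) by rewrite EM.
have [j jE] : exists j, q = j.+1 by exists q.-1; lia.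
rewrite jE subn1 /= in big2 h nk4 EM2 nk.
clear - big2 h nk4 EM2 nk.
lia.
Qed.

(** Here [d] is the degree of a vertex, [t] the degree sum of its neighbours and [s] that of the
    remaining vertices. *)
Lemma nonadj_bound_signless n k E M d t s : (E + M + n = n * n -> 6 * k + 11 <= n ->
  0 < d -> E = d + t + s -> t <= d ^ 2 + s -> t <= d * (n - 1) -> d <= n - 1 ->
  2 * (n - k - 1) * d < d ^ 2 + t -> k ^ 2 + 2 * k + 3 <= n ->
  M + 3 <= 2 * ((k + 1) * (n - k - 2)))%N.
Proof.
move=> EM nk d0 EE; rewrite -!mulnn => t1 t2 dn h nk2.
have [r rE] : exists r, n = d + r + 1 by exists (n - 1 - d); lia.
have e3 : n - 1 = d + r by lia.
rewrite e3 in t2.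
(* This is d + t/d <= E/(n - 1) + n - 2, cleared of denominators. For r > d, the two bounds on [t]
   are combined with weights d and r - d. *)
have key : t * r + d * r <= d * s + d * r * (d + r).
  case: (leqP r d) => rd.
    have : t * r <= (d * d + s) * r by rewrite leq_mul2r t1 orbT.
    have : s * r <= d * s by rewrite mulnC leq_mul2r rd orbT.
    clear - d0; case: (r) => [|r']; nia.
  have : t * d <= (d * d + s) * d by rewrite leq_mul2r t1 orbT.
  have : t * (r - d) <= d * (d + r) * (r - d) by rewrite leq_mul2r t2 orbT.
  have [j jE] : exists j, r = d + j by exists (r - d); lia.
  have -> : r - d = j by lia.
  have : d * (d + j) <= d * (d + j) * d by rewrite leq_pmulr.
  by rewrite jE; clear - d0; lia.
(* From 2(n - k - 1) < d + t/d and [key], E > (n - 1)(n - 2k). *)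
have Mk : M < 2 * k * (d + r).
  rewrite -(ltn_pmul2l d0).
  have h2 : (2 * (n - k - 1) * d).+1 * (d + r) <= (d * d + t) * (d + r).
    by rewrite leq_mul2r h orbT.
  have e4 : n - k - 1 = d + r - k by lia.
  have [j jE] : exists j, d + r = j + k by exists (d + r - k); lia.
  have EMd : (d + t + s + M + (d + r + 1)) * d = (d + r + 1) * (d + r + 1) * d.
    by rewrite -EE -rE EM.
  rewrite e4 jE addnK in h2; clear - h2 key EMd jE d0.
  have h3 : 2 * (j * (j + k)) * d + (j + k) <= (d * d + t) * (j + k) by clear - h2; lia.
  rewrite -jE in h3.
  have : 2 * (j * (d + r)) * d + 2 * k * (d + r) * d = 2 * (d + r) * (d + r) * d.
    by rewrite [in RHS]jE; lia.
  have dr : 0 < d + r by lia.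
  clear h2; lia.
(* M is at most 2k(j + k + 1) - 1, and the target 2(k + 1)j - 3 reaches this precisely when j >= k^2
   + k + 1, that is n >= k^2 + 2k + 3. *)
have [j jE] : exists j, n = j + k + 2 by exists (n - k - 2); lia.
have -> : n - k - 2 = j by lia.
clear - Mk jE rE nk2.
have e5 : d + r = j + k + 1 by lia.
rewrite e5 jE in Mk nk2.
lia.
Qed.

(** * Rayleigh quotients *)

Section Rayleigh.
Local Open Scope ring_scope.
Variable R : realType.

Section ComplexDiag.
Import complex.
Local Open Scope sesquilinear_scope.

(** Over the complex numbers [M] is unitarily diagonalisable. Its diagonal entries are real
    eigenvalues of [M], and in the coordinates [y] of [v] the form is their sum weighted by the
    squared moduli. *)
Lemma rayleigh_le m (M : 'M[R]_m) (v : 'rV[R]_m) : (0 < m)%N -> M^T = M ->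
  (v *m M *m v^T) 0 0 <= max_eigenvalue M * (v *m v^T) 0 0.
Proof.
case: m M v => // m M v m0 Msym.
have [_ lmax] := max_eigenvalueP m0 Msym; set l := max_eigenvalue M in lmax *.
pose f := real_complex R; pose N := map_mx f M.
have Nh : N \is hermsymmx.
  apply: realsym_hermsym.
    apply/is_hermitianmxP; rewrite expr0 scale1r map_mx_id //.
    by apply/matrixP => i j; rewrite !mxE -{1}Msym mxE.
  apply/mxOverP => i j; rewrite mxE; apply/complex_realP; by exists (M i j).
have := hermitian_spectral_diag_real Nh.
have /orthomx_spectralP := hermitian_normalmx Nh.
have := spectral_unitarymx N.
set P := spectralmx N; set d := spectral_diag N => PU defN dR.
have Pu : P \in unitmx by apply: spectral_unit.
have dle i : d 0 i <= f l.
  have dRi : d 0 i \is Num.real by move/mxOverP: dR; apply.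
  rewrite -(RRe_real dRi) lecR; apply: lmax.
  rewrite -(eigenvalue_map f) /f /= RRe_real //.
  apply/eigenvalueP; exists (row i P).
    rewrite -/N {1}defN !mulmxA -row_mul mulmxV // -row_mul mul1mx.
    by rewrite row_diag_mx -scalemxAl -rowE.
  apply/eqP => P0; move: Pu; rewrite -row_free_unit => /row_freeP[B PB].
  have := congr1 (fun X => row i X 0 i) PB.
  by rewrite row_mul P0 mul0mx !mxE eqxx => /eqP; rewrite eq_sym oner_eq0.
pose w := map_mx f v; pose y := w *m invmx P.
have wR : w^T = w ^t* by apply/matrixP => i j; rewrite !mxE; apply/esym/conjc_real.
have PV : invmx P = P ^t* by rewrite invmx_unitary.
have yV : y ^t* = P *m w^T.
  rewrite /y PV trmx_mul map_mxM -wR; congr (_ *m _).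
  by apply/matrixP => i j; rewrite !mxE; apply: conjcK.
have qN : w *m N *m w^T = y *m diag_mx d *m y ^t* by rewrite yV {1}defN !mulmxA.
have q1 : w *m w^T = y *m y ^t* by rewrite yV /y mulmxA mulmxKV.
have fM a b : f (a * b) = f a * f b by apply: rmorphM.
rewrite -lecR -!/(f _) fM.
have -> : f ((v *m M *m v^T) 0 0) = (w *m N *m w^T) 0 0.
  by rewrite /w /N -map_mxM map_trmx -map_mxM [RHS]mxE.
have -> : f ((v *m v^T) 0 0) = (w *m w^T) 0 0 by rewrite map_trmx -map_mxM [RHS]mxE.
rewrite qN q1; move: {yV qN q1} y => y.
rewrite mul_mx_diag !mxE mulr_sumr; apply: ler_sum => i _.
rewrite !mxE [y 0 i * d 0 i]mulrC -mulrA; apply: ler_wpM2r (dle i).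
by rewrite -normCK exprn_ge0.
Qed.

End ComplexDiag.

(* Perturb x in the direction z = x S. *)
Lemma psd_kernel m (S : 'M[R]_m) (x : 'rV[R]_m) : S^T = S ->
  (forall v : 'rV_m, 0 <= (v *m S *m v^T) 0 0) -> (x *m S *m x^T) 0 0 = 0 ->
  x *m S = 0.
Proof.
move=> Ssym psd x0; set z := x *m S.
have zE : (z *m z^T) 0 0 = \sum_i z 0 i ^+ 2.
  by rewrite mxE; apply: eq_bigr => i _; rewrite [z^T _ _]mxE expr2.
have Bz := psd z; set c := (z *m S *m z^T) 0 0 in Bz.
suff b0 : (z *m z^T) 0 0 = 0.
  move: b0; rewrite zE => /psumr_eq0P h.
  apply/rowP => i; rewrite [RHS]mxE; apply/eqP; rewrite -sqrf_eq0.
  by apply/eqP/h => // j _; exact: sqr_ge0.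
set b := (z *m z^T) 0 0 in zE *.
have b_ge0 : 0 <= b by rewrite zE sumr_ge0 // => i _; exact: sqr_ge0.
have pert t : 0 <= 2 * t * b + t ^+ 2 * c.
  have := psd (x + t *: z).
  have -> : (x + t *: z) *m S *m (x + t *: z)^T =
      x *m S *m x^T + t *: (x *m S *m z^T) + t *: (z *m S *m x^T)
      + t ^+ 2 *: (z *m S *m z^T).
    rewrite linearD /= linearZ /= !(mulmxDl, mulmxDr) -!scalemxAl -!scalemxAr.
    by rewrite scalerA -expr2 !addrA; congr (_ + _); rewrite -!addrA; congr (_ + _); rewrite addrC.
  have -> : z *m S *m x^T = z *m z^T by rewrite -mulmxA -{1}Ssym -trmx_mul.
  have addE (A B : 'M[R]_1) : (A + B) 0 0 = A 0 0 + B 0 0 by rewrite mxE.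
  have sclE a (A : 'M[R]_1) : (a *: A) 0 0 = a * A 0 0 by rewrite mxE.
  rewrite !addE !sclE x0 -/z -/b -/c add0r.
  by rewrite (_ : t * b + t * b = 2 * t * b) //; ring.
apply/eqP; rewrite eq_le b_ge0 andbT leNgt; apply/negP => b_gt0.
have c1 : 0 < c + 1 by rewrite ltr_wpDl.
(* The minimiser would be -b/c; using c + 1 avoids division by zero and still gives a negative
   value. *)
have := pert (- b / (c + 1)); apply/negP; rewrite -ltNge.
have -> : 2 * (- b / (c + 1)) * b + (- b / (c + 1)) ^+ 2 * c =
   - (b ^+ 2 * (c + 2) / (c + 1) ^+ 2) by field; rewrite gt_eqF.
by rewrite oppr_lt0 divr_gt0 ?exprn_gt0 // mulr_gt0 ?exprn_gt0 // ltr_wpDl.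
Qed.

(** With l the largest eigenvalue, l I - M is positive semidefinite, and its form vanishes at
    [v]. *)
Lemma rayleigh_eq m (M : 'M[R]_m) (v : 'rV[R]_m) : (0 < m)%N -> M^T = M ->
  (v *m M *m v^T) 0 0 = max_eigenvalue M * (v *m v^T) 0 0 ->
  v *m M = max_eigenvalue M *: v.
Proof.
move=> m0 Msym vE; set l := max_eigenvalue M in vE *.
have SE w : (w *m (l%:M - M) *m w^T) 0 0 = l * (w *m w^T) 0 0 - (w *m M *m w^T) 0 0.
  by rewrite mulmxBr mulmxBl mul_mx_scalar -scalemxAl !mxE.
have : v *m (l%:M - M) = 0.
  apply: psd_kernel; last by rewrite SE vE subrr.
    by rewrite linearB /= tr_scalar_mx Msym.
  by move=> w; rewrite SE subr_ge0 rayleigh_le.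
by rewrite mulmxBr mul_mx_scalar => /eqP; rewrite subr_eq0 => /eqP ->.
Qed.

End Rayleigh.

(** * Quadratic forms of graphs *)

Section Forms.
Local Open Scope ring_scope.
Variable R : realType.

(** The operator A + bD on functions on the vertices, with the degree term spread over the
    neighbours. Functions, unlike row vectors, do not depend on an enumeration of the vertices. *)
Definition qop (T : finType) (r : rel T) (b : R) (x : T -> R) (u : T) : R :=
  \sum_v (r u v)%:R * (x v + b * x u).

Definition qform (T : finType) (r : rel T) b (x : T -> R) : R :=
  \sum_u x u * qop r b x u.

(* b = 0 gives the adjacency matrix, b = 1 the signless Laplacian. *)
Definition bmx (b : R) (G : sgraph) := adjacency_mx R G + b *: degree_mx R G.

Definition radius b G := max_eigenvalue (bmx b G).

Lemma spectral_radiusE G : spectral_radius R G = radius 0 G.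
Proof. by rewrite /radius /bmx scale0r addr0. Qed.

Lemma signless_spectral_radiusE G : signless_spectral_radius R G = radius 1 G.
Proof. by rewrite /radius /bmx scale1r. Qed.

Lemma bmx_sym b G : (bmx b G)^T = bmx b G.
Proof.
by rewrite /bmx linearD /= linearZ /= adjacency_mx_sym /degree_mx tr_diag_mx.
Qed.

Lemma natr_degree (G : sgraph) (u : G) : (degree u)%:R = \sum_v (adj u v)%:R :> R.
Proof.
rewrite /degree -sum1_card natr_sum big_mkcond; apply: eq_bigr => v _.
by rewrite inE; case: (adj u v).
Qed.

Lemma big_enum_val (T : finType) (F : T -> R) :
  \sum_(i < #|T|) F (enum_val i) = \sum_u F u.
Proof.
rewrite [RHS](reindex (@enum_val T T)) //.
by exists enum_rank => u _; rewrite ?enum_valK ?enum_rankK.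
Qed.

Lemma mul_bmx b (G : sgraph) (x : G -> R) (u : G) :
  ((\row_i x (enum_val i)) *m bmx b G) 0 (enum_rank u) = qop (@adj G) b x u.
Proof.
rewrite mxE /qop.
under eq_bigr => i _ do rewrite !mxE.
rewrite (eq_bigr (fun i : 'I_#|G| => (adj u (enum_val i))%:R * x (enum_val i) +
   (if i == enum_rank u then b * (degree u)%:R * x u else 0))); last first.
  move=> i _; rewrite enum_rankK adj_sym mulrDr [x _ * _]mulrC; congr (_ + _).
  have [->|_] := eqVneq i (enum_rank u); last by rewrite mulr0n !mulr0.
  by rewrite enum_rankK mulr1n mulrC.
rewrite big_split /= -big_mkcond big_pred1_eq /=.
rewrite (big_enum_val (fun v => (adj u v)%:R * x v)).
rewrite natr_degree mulr_sumr mulr_suml -big_split; apply: eq_bigr => v _ /=.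
by ring.
Qed.

Lemma row_fun_form b (G : sgraph) (x : G -> R) (v := \row_i x (enum_val i)) :
  ((v *m bmx b G *m v^T) 0 0 = qform (@adj G) b x) *
  ((v *m v^T) 0 0 = \sum_u x u ^+ 2).
Proof.
split; rewrite mxE.
  rewrite /qform -(big_enum_val (fun u => x u * qop (@adj G) b x u)); apply: eq_bigr => i _.
  by rewrite -mul_bmx enum_valK mulrC [v^T _ _]mxE mxE.
rewrite -(big_enum_val (fun u => x u ^+ 2)); apply: eq_bigr => i _.
by rewrite !mxE expr2.
Qed.

Lemma radius_ge b (G : sgraph) (x : G -> R) : (0 < #|G|)%N ->
  qform (@adj G) b x <= radius b G * \sum_u x u ^+ 2.
Proof.
by move=> G0; rewrite -!(row_fun_form b) rayleigh_le // bmx_sym.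
Qed.

Lemma radius_eq b (G : sgraph) (x : G -> R) : (0 < #|G|)%N ->
  qform (@adj G) b x = radius b G * \sum_u x u ^+ 2 ->
  forall u, qop (@adj G) b x u = radius b G * x u.
Proof.
move=> G0; rewrite -!(row_fun_form b) => /rayleigh_eq h u.
by rewrite -mul_bmx h ?bmx_sym // !mxE enum_rankK.
Qed.

Lemma radius_eigenfun b (G : sgraph) : (0 < #|G|)%N ->
  exists2 x : G -> R, exists u, x u != 0 &
    forall u, qop (@adj G) b x u = radius b G * x u.
Proof.
move=> G0; have [/eigenvalueP[v vE v0] _] := max_eigenvalueP G0 (bmx_sym b G).
exists (fun u => v 0 (enum_rank u)).
  have /rV0Pn[i vi] := v0; by exists (enum_val i); rewrite enum_valK.
move=> u; rewrite -mul_bmx.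
rewrite (_ : \row_i _ = v) ?vE ?mxE //.
by apply/rowP => i; rewrite mxE enum_valK.
Qed.

End Forms.

(** * The extremal graph on a given vertex set *)

Section HubGraph.
Local Open Scope ring_scope.
Variables (T : finType).

(** Two cliques, [H] and its complement, plus all edges at [a]. For [a] in [H] this is a copy of
    L_{n,k} on the vertices of G, so both forms can be evaluated at the same function. *)
Definition hub_adj (a : T) (H : {set T}) : rel T :=
  fun u v => (u != v) && [|| u == a, v == a | (u \in H) == (v \in H)].

Lemma hub_graph_bij (a : T) (H : {set T}) n k : #|T| = n -> #|H| = (n - k)%N ->
  (k < n)%N -> a \in H ->
  exists2 g : Lgraph n k -> T, bijective g & {mono g : i j / adj i j >-> hub_adj a H i j}.
Proof.
move=> Tn Hn kn aH.
have sH : size (enum (H :\ a)) = (n - k - 1)%N.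
  by rewrite -cardE; have := cardsD1 a H; rewrite aH; lia.
have sS : size (enum (~: H)) = k by rewrite -cardE; have := cardsC H; lia.
pose g (i : Lgraph n k) : T := match i with
  | inl _ => a
  | inr (inl i) => nth a (enum (H :\ a)) (nat_of_ord (i : 'I_(n - k - 1)))
  | inr (inr i) => nth a (enum (~: H)) (nat_of_ord (i : 'I_k))
  end.
have gH (i : 'I_(n - k - 1)) : g (inr (inl i)) \in H :\ a.
  by rewrite /= -mem_enum mem_nth // sH.
have gS (i : 'I_k) : g (inr (inr i)) \in ~: H.
  by rewrite /= -mem_enum mem_nth // sS.
have gHa (i : 'I_(n - k - 1)) : (g (inr (inl i)) == a = false) * (g (inr (inl i)) \in H).
  by have := gH i; rewrite !inE => /andP[/negPf -> ->].
have gSa (i : 'I_k) : (g (inr (inr i)) == a = false) * (g (inr (inr i)) \in H = false).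
  have := gS i; rewrite inE => /negPf h; split=> //.
  by apply: contraFF h => /eqP ->.
have ginj : injective g.
  case=> [i|[i|i]] [j|[j|j]] // gij.
  - by rewrite (ord1 i) (ord1 j).
  - by have := gHa j; rewrite -gij /= eqxx => -[].
  - by have := gSa j; rewrite -gij /= eqxx => -[].
  - by have := gHa i; rewrite gij /= eqxx => -[].
  - congr (inr (inl _)); apply/val_inj/eqP.
    rewrite -(nth_uniq a (s := enum (H :\ a))) ?sH ?enum_uniq //.
    + exact/eqP.
    + exact: ltn_ord.
    + exact: ltn_ord.
  - by have [_] := gHa i; rewrite gij gSa.
  - by have := gSa i; rewrite gij /= eqxx => -[].
  - by have [_] := gHa j; rewrite -gij gSa.
  - congr (inr (inr _)); apply/val_inj/eqP.
    rewrite -(nth_uniq a (s := enum (~: H))) ?sS ?enum_uniq //.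
    + exact/eqP.
    + exact: ltn_ord.
    + exact: ltn_ord.
exists g; first by apply: inj_card_bij => //; rewrite card_Lgraph // Tn.
move=> i j; rewrite /hub_adj (inj_eq ginj).
case: i j => [i|[i|i]] [j|[j|j]]; rewrite ?gHa ?gSa ?[g (inl _) == a]eqxx //=.
- by rewrite (ord1 i) (ord1 j) eqxx.
all: by rewrite ?andbT ?andbF ?orbT.
Qed.

End HubGraph.

(** * Spectral bounds *)

Section HubRadius.
Local Open Scope ring_scope.
Variables (R : realType) (T : finType) (a : T) (H : {set T}) (n k : nat).
Hypotheses (Tn : #|T| = n) (Hn : #|H| = (n - k)%N) (kn : (k < n)%N) (aH : a \in H).
Implicit Type x : T -> R.

Let L0 : (0 < #|Lgraph n k|)%N. Proof. by rewrite card_Lgraph //; lia. Qed.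

Let reindex_hub b (g : Lgraph n k -> T) x : bijective g ->
  {mono g : i j / adj i j >-> hub_adj a H i j} ->
  [/\ qform (@adj _) b (x \o g) = qform (hub_adj a H) b x,
      \sum_i (x \o g) i ^+ 2 = \sum_u x u ^+ 2 &
      forall i, qop (@adj _) b (x \o g) i = qop (hub_adj a H) b x (g i)].
Proof.
move=> gb gm; have gT := onW_bij predT gb.
have opE i : qop (@adj _) b (x \o g) i = qop (hub_adj a H) b x (g i).
  rewrite /qop [RHS](reindex g) //=.
  by apply: eq_bigr => j _; rewrite gm.
split; [|by rewrite [RHS](reindex g)|exact: opE].
rewrite /qform [RHS](reindex g) //=.
by apply: eq_bigr => i _; rewrite opE.
Qed.

Lemma hub_form_le b x :
  qform (hub_adj a H) b x <= radius b (Lgraph n k) * \sum_u x u ^+ 2.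
Proof.
have [g gb gm] := hub_graph_bij Tn Hn kn aH.
by have [<- <- _] := reindex_hub b x gb gm; apply: radius_ge.
Qed.

Lemma hub_form_eq b x :
  qform (hub_adj a H) b x = radius b (Lgraph n k) * \sum_u x u ^+ 2 ->
  forall u, qop (hub_adj a H) b x u = radius b (Lgraph n k) * x u.
Proof.
have [g gb gm] := hub_graph_bij Tn Hn kn aH.
have [<- <- opE] := reindex_hub b x gb gm => /(radius_eq L0) h u.
by have [g' _ gK] := gb; rewrite -(gK u) -opE h.
Qed.

(** Each vertex of [H] has n - k - 1 neighbours in [H], contributing 1 + b each; the hub has k more
    outside, contributing b each. *)
Lemma hub_clique_form b :
  qform (hub_adj a H) b (fun u => (u \in H)%:R) =
  (n - k)%:R * ((n - k - 1)%:R * (1 + b)) + b * k%:R :> R.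
Proof.
have opE u : u \in H -> qop (hub_adj a H) b (fun v => (v \in H)%:R) u =
    (n - k - 1)%:R * (1 + b) + (u == a)%:R * (b * k%:R).
  move=> uH; rewrite /qop uH (bigID (mem H)) /=; congr (_ + _).
    rewrite (eq_bigr (fun v => (u != v)%:R * (1 + b))); last first.
      by move=> v vH; rewrite /hub_adj uH vH eqxx !orbT andbT mulr1.
    rewrite -mulr_suml; congr (_ * _); rewrite (big_setD1 u) //= eqxx add0r.
    rewrite (eq_bigr (fun=> 1)) => [|v]; last by rewrite !inE eq_sym => /andP[->].
    by rewrite sumr_const; congr (_%:R); have := cardsD1 u H; rewrite uH; lia.
  rewrite (eq_bigr (fun v => (u == a)%:R * b)); last first.
    move=> v vH; rewrite /hub_adj uH (negPf vH) orbF add0r mulr1.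
    have -> : (u != v) by apply: contraNneq vH => <-.
    by rewrite [v == a](contraNF _ vH) ?orbF // => /eqP ->.
  rewrite sumr_const -[LHS]mulr_natr -mulrA; congr (_ * (_ * _%:R)).
  have -> : #|[predC H]| = #|~: H| by apply: eq_card => v; rewrite !inE.
  by have := cardsC H; lia.
rewrite /qform (bigID (mem H)) /= [X in _ + X]big1 ?addr0; last first.
  by move=> u /negPf ->; rewrite mul0r.
rewrite (eq_bigr (fun u => (n - k - 1)%:R * (1 + b) + (u == a)%:R * (b * k%:R))).
  rewrite big_split /= sumr_const Hn -[X in X + _ = _]mulr_natl; congr (_ + _).
  rewrite (bigD1 a) //= eqxx mul1r big1 ?addr0 // => u.
  by case/andP => _ /negPf ->; rewrite mul0r.
by move=> u uH; rewrite opE // uH mul1r.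
Qed.

Lemma hub_clique_norm : \sum_u (u \in H)%:R ^+ 2 = (n - k)%:R :> R.
Proof.
rewrite -Hn -sum1_card natr_sum [RHS]big_mkcond; apply: eq_bigr => u _.
by case: (u \in H); rewrite ?expr1n ?expr0n.
Qed.

Lemma radius_Lgraph_adj : (n - k - 1)%:R <= radius 0 (Lgraph n k) :> R.
Proof.
have := hub_form_le 0 (fun u => (u \in H)%:R).
rewrite hub_clique_norm hub_clique_form addr0 mul0r addr0 mulr1 mulrC.
by rewrite ler_pM2r // ltr0n; lia.
Qed.

(** The indicator of [H] has Rayleigh quotient 2(n - k - 1) + k/(n - k); the edges leaving [H] make
    the bound strict. *)
Lemma radius_Lgraph_signless : (0 < k)%N ->
  (2 * (n - k - 1))%:R < radius 1 (Lgraph n k) :> R.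
Proof.
move=> k0; have := hub_form_le 1 (fun u => (u \in H)%:R).
rewrite hub_clique_norm hub_clique_form mul1r => h.
have N0 : 0 < (n - k)%:R :> R by rewrite ltr0n; lia.
rewrite -(ltr_pM2r N0); apply: lt_le_trans h.
have kR : 0 < k%:R :> R by rewrite ltr0n.
by rewrite natrM; lra.
Qed.

End HubRadius.

Section UpperBounds.
Local Open Scope ring_scope.
Variables (R : realType) (T : finType) (e : rel T).
Hypotheses (esym : symmetric e) (eirr : irreflexive e).
Implicit Type x : T -> R.

Let E2 := \sum_u deg_in e setT u.

Let E2R : E2%:R = \sum_u \sum_v (e u v)%:R :> R.
Proof.
rewrite natr_sum; apply: eq_bigr => u _; rewrite deg_inE natr_sum.
by apply: eq_bigl => v; rewrite inE.
Qed.

(** Cauchy-Schwarz, by expanding a sum of squared deviations. *)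
Lemma sum_squares_le x :
  (\sum_u x u ^+ 2) ^+ 2 <= #|T|%:R * \sum_u x u ^+ 4.
Proof.
have [T0|T0] := posnP #|T|.
  have T0' : T =i pred0 by apply/card0_eq.
  by rewrite !big1 ?expr0n ?mulr0 // => u; have := T0' u; rewrite !inE.
have n0 : 0 < #|T|%:R :> R by rewrite ltr0n.
set N := \sum_u x u ^+ 2.
have : 0 <= \sum_u (#|T|%:R * x u ^+ 2 - N) ^+ 2.
  by apply: sumr_ge0 => u _; apply: sqr_ge0.
have -> : \sum_u (#|T|%:R * x u ^+ 2 - N) ^+ 2 =
    #|T|%:R ^+ 2 * (\sum_u x u ^+ 4) - 2 * #|T|%:R * N * N + #|T|%:R * N ^+ 2.
  rewrite (eq_bigr (fun u => #|T|%:R ^+ 2 * x u ^+ 4 +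
    ((- (2 * #|T|%:R * N)) * x u ^+ 2 + N ^+ 2))); last by move=> u _; ring.
  rewrite !big_split /= -!mulr_sumr sumr_const -mulr_natl -/N; ring.
move=> h; rewrite -subr_ge0 -(pmulr_rge0 _ n0).
by apply: le_trans h _; rewrite le_eqVlt; apply/orP; left; apply/eqP; ring.
Qed.

(* Expanding the sum over u != v of (e u v - t x_u x_v)^2 with the optimal t. *)
Lemma adj_radius_edges x (l : R) : (1 < #|T|)%N ->
  0 < \sum_u x u ^+ 2 -> qform e 0 x = l * \sum_u x u ^+ 2 ->
  l ^+ 2 * #|T|%:R <= E2%:R * (#|T| - 1)%:R.
Proof.
move=> n1 N0 lE; have S4 := sum_squares_le x; set N := \sum_u x u ^+ 2 in N0 lE S4 *.
set n := #|T|%:R in S4 *; set X4 := \sum_u x u ^+ 4 in S4.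
have n0 : 1 < n by rewrite ltr1n.
rewrite natrB; last by lia.
rewrite -/n.
have pos t : 0 <= E2%:R - 2 * t * (l * N) + t ^+ 2 * (N ^+ 2 - X4).
  have : 0 <= \sum_u \sum_v (u != v)%:R * ((e u v)%:R - t * (x u * x v)) ^+ 2.
    by apply: sumr_ge0 => u _; apply: sumr_ge0 => v _; rewrite mulr_ge0 ?sqr_ge0.
  rewrite (_ : \sum_u _ = E2%:R - 2 * t * (l * N) + t ^+ 2 * (N ^+ 2 - X4)) //.
  rewrite -lE /qform /qop E2R.
  have -> : N ^+ 2 - X4 = \sum_u \sum_v (u != v)%:R * (x u ^+ 2 * x v ^+ 2).
    rewrite expr2 {1}/N mulr_suml -sumrB; apply: eq_bigr => u _.
    rewrite mulr_sumr (bigD1 u) //= [RHS](bigD1 u) //= eqxx mul0r add0r.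
    rewrite addrAC -exprD subrr add0r; apply: eq_bigr => v vu.
    by rewrite eq_sym vu mul1r.
  rewrite !mulr_sumr -sumrB -big_split; apply: eq_bigr => u _ /=.
  rewrite mulrA !mulr_sumr -sumrB -big_split; apply: eq_bigr => v _ /=.
  have [<-|_] := eqVneq u v; first by rewrite eirr /= ?mulr0n; ring.
  by case: (e u v); rewrite /= ?mulr1n ?mulr0n; ring.
(* The minimiser in t once N^2 - X4 is replaced by its upper bound N^2 (n - 1)/n. *)
have := pos (l * n / ((n - 1) * N)).
have n10 : 0 < n - 1 by rewrite subr_gt0.
set t := l * n / _ => h.
have h2 : t ^+ 2 * (N ^+ 2 - X4) <= t ^+ 2 * (N ^+ 2 * (n - 1) / n).
  apply: ler_wpM2l; first exact: sqr_ge0.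
  rewrite ler_pdivlMr; last by lra.
  by rewrite mulrBl; lra.
have : 0 <= E2%:R - 2 * t * (l * N) + t ^+ 2 * (N ^+ 2 * (n - 1) / n).
  by apply: le_trans h _; lra.
have -> : E2%:R - 2 * t * (l * N) + t ^+ 2 * (N ^+ 2 * (n - 1) / n) =
   (E2%:R * (n - 1) - l ^+ 2 * n) / (n - 1).
  by rewrite /t; field; rewrite !gt_eqF //; lra.
by rewrite pmulr_lge0 ?invr_gt0 // subr_ge0.
Qed.

(** At a vertex maximising |x_u| / d_u, the eigenvalue equation gives l <= d_u + t/d_u, with t the
    degree sum of the neighbours. *)
Lemma signless_radius_vertex x (l : R) (c : nat) : (exists u, x u != 0) ->
  (forall u, qop e 1 x u = l * x u) -> c%:R < l ->
  exists u, (0 < deg_in e setT u /\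
    c * deg_in e setT u < deg_in e setT u ^ 2 +
      \sum_(v | e u v) deg_in e setT v)%N.
Proof.
move=> [u1 xu1] lE cl; pose d u : R := (deg_in e setT u)%:R.
have l0 : 0 < l by apply: le_lt_trans cl.
have dE u : d u = \sum_v (e u v)%:R.
  by rewrite /d deg_inE natr_sum; apply: eq_bigl => v; rewrite inE.
have d_ge0 u : 0 <= d u by rewrite ler0n.
(* At isolated vertices the equation reads 0 = l x_u. The quotient below is then 0, so such vertices
   do not disturb the maximum. *)
have d0 u : d u = 0 -> x u = 0.
  move=> du; have /eqP := lE u; rewrite /qop big1.
    by rewrite eq_sym mulf_eq0 gt_eqF //= => /eqP.
  move=> v _; have -> : (e u v)%:R = 0 :> R; last by rewrite mul0r.
  by move: du; rewrite dE => /psumr_eq0P; apply.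
have [u umax] : exists u, forall v, `|x v| / d v <= `|x u| / d u.
  have [u _ umax] := Order.TotalTheory.arg_maxP (P := predT) (i0 := u1)
    (fun u => `|x u| / d u) isT.
  by exists u => v; apply: umax.
set y := `|x u| / d u in umax.
have le_y v : `|x v| <= y * d v.
  have [dv|dv] := eqVneq (d v) 0; first by rewrite (d0 v dv) normr0 dv mulr0.
  by rewrite -ler_pdivrMr ?umax // lt_def dv d_ge0.
have y0 : 0 < y.
  have yd : 0 < y * d u1 by apply: lt_le_trans (le_y u1); rewrite normr_gt0.
  have y_ge0 : 0 <= y by rewrite divr_ge0.
  by rewrite lt_def y_ge0 andbT; apply: contraTneq yd => ->; rewrite mul0r ltxx.
have du : d u != 0 by apply: contraTneq y0; rewrite /y => ->; rewrite invr0 mulr0 ltxx.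
have du0 : 0 < d u by rewrite lt_def du d_ge0.
have xuE : `|x u| = y * d u by rewrite /y divfK.
exists u; split; first by rewrite -(ltr0n R).
rewrite -(ltr_nat R) natrM natrD natrX -/(d u) natr_sum.
apply: (@lt_le_trans _ _ (l * d u)); first by rewrite ltr_pM2r.
rewrite -(ler_pM2l y0) mulrCA -xuE -{1}(gtr0_norm l0) -normrM -lE /qop.
apply: le_trans (ler_norm_sum _ _ _) _.
rewrite [X in _ <= y * (_ + X)]big_mkcond /= expr2 {1}dE mulr_suml -big_split mulr_sumr.
apply: ler_sum => v _ /=; rewrite normrM normr_nat mul1r.
case: (e u v); rewrite ?mul0r ?addr0 ?mulr0 // !mul1r addrC mulrDr -xuE.
by apply: le_trans (ler_normD _ _) _; rewrite lerD2r le_y.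
Qed.

(** [s] is the degree sum outside the closed neighbourhood [U] of [u]. Each neighbour of [u] has at
    most d neighbours inside [U], and the edges it sends out of [U] are counted in [s]. *)
Lemma edges_through_vertex u (d := deg_in e setT u)
    (t := (\sum_(v | e u v) deg_in e setT v)%N) :
  exists s, [/\ E2 = (d + t + s)%N, (t <= d ^ 2 + s)%N, (t <= d * (#|T| - 1))%N
    & (d <= #|T| - 1)%N].
Proof.
pose N := [set v | e u v].
have dN : d = #|N| by apply: eq_card => v; rewrite !inE.
have uN : u \notin N by rewrite inE eirr.
have tE : t = pairs e N setT.
  by rewrite /t /pairs; apply: eq_big => v; rewrite ?inE // => _; rewrite deg_inE.
have EE : E2 = pairs e setT setT.
  by rewrite /E2 /pairs; apply: eq_big => v; rewrite ?inE // => _; rewrite deg_inE.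
have dT v : (deg_in e setT v <= #|T| - 1)%N.
  by have := deg_in_nonadj setT v eirr; rewrite inE cardsT; lia.
pose U := u |: N.
have E3 : E2 = (pairs e U setT + pairs e (setT :\: U) setT)%N.
  by rewrite EE (@pairs_setIDr _ _ setT U) ?subsetT // !(pairsC setT).
have UE : pairs e U setT = (d + t)%N.
  by rewrite tE /pairs (big_setU1 _ uN) /= /d deg_inE.
exists (pairs e (setT :\: U) setT); split; last exact: dT.
- by rewrite E3 UE.
- rewrite tE (@pairs_setIDr _ _ N U) ?subsetT // leq_add //.
    rewrite -mulnn dN /pairs -[X in (_ <= X)%N]sum_nat_const; apply: leq_sum => v vN.
    have := deg_in_nonadj U v eirr; rewrite deg_inE /U cardsU1 uN inE vN orbT /=; lia.
  rewrite (pairsC N) //; apply: leq_sum => v _.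
  by rewrite [X in (_ <= X)%N](big_setID N) /= setTI leq_addr.
rewrite /t -(eq_bigl _ _ (fun v => in_set (e u) v)) dN -sum_nat_const.
by apply: leq_sum => v _; apply: dT.
Qed.

End UpperBounds.

(** * Spectral hypotheses force few nonadjacent pairs *)

Section FewNonadjacent.
Local Open Scope ring_scope.
Variables (R : realType) (k : nat) (G : sgraph).
Hypotheses (k_ge1 : (1 <= k)%N).
Let n := #|G|.
Hypothesis (nk : (6 * k + 11 <= n)%N).

Let edges_nonadj : (\sum_(u : G) deg_in (@adj G) setT u +
  pairs (nonadj (@adj G)) setT setT + n = n * n)%N.
Proof.
have := sum_deg_in setT (@adj_irr G); rewrite cardsT -/n => <-.
by congr (_ + _ + _)%N; apply: eq_bigl => u; rewrite inE.
Qed.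

Let clique : exists (H : {set G}) a, #|H| = (n - k)%N /\ a \in H.
Proof.
have [H _ Hn] : exists2 H : {set G}, H \subset setT & #|H| = (n - k)%N.
  by apply: subset_of_card; rewrite cardsT -/n; lia.
have /card_gt0P[a aH] : (0 < #|H|)%N by rewrite Hn; lia.
by exists H, a.
Qed.

Lemma few_nonadj_adjacency : radius 0 (Lgraph n k) <= radius 0 G :> R ->
  ((k + 3) * (k + 4) %/ 2 <= n)%N ->
  (pairs (nonadj (@adj G)) setT setT + 3 <= 2 * ((k + 1) * (n - k - 2)))%N.
Proof.
move=> LG nk2; have [H [a [Hn aH]]] := clique.
have kn : (k < n)%N by lia.
have lL := le_trans (@radius_Lgraph_adj R _ a H n k erefl Hn kn aH) LG.
have G0 : (0 < #|G|)%N by rewrite -/n; lia.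
have [x [u xu] xE] := @radius_eigenfun R 0 G G0.
have N0 : 0 < \sum_u x u ^+ 2.
  rewrite (bigD1 u) //= ltr_wpDr ?exprn_even_gt0 //.
  by apply: sumr_ge0 => v _; apply: sqr_ge0.
have fE : qform (@adj G) 0 x = radius 0 G * \sum_u x u ^+ 2.
  by rewrite mulr_sumr; apply: eq_bigr => v _; rewrite xE; ring.
have n1 : (1 < #|G|)%N by rewrite -/n; lia.
have := adj_radius_edges (@adj_irr G) n1 N0 fE; rewrite -/n => h.
have : ((n - k - 1) ^ 2 * n)%:R <=
    ((\sum_(u : G) deg_in (@adj G) setT u) * (n - 1))%:R :> R.
  rewrite [leLHS]natrM natrX [leRHS]natrM; apply: le_trans h; rewrite ler_wpM2r // ler_sqr ?nnegrE //.
  exact: le_trans lL.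
rewrite ler_nat => {}h.
apply: nonadj_bound_adjacency edges_nonadj nk h _.
(* One of two consecutive integers is even, so the halving in the hypothesis is exact. *)
have : (2 %| (k + 3) * (k + 4))%N by rewrite dvdn2 oddM !oddD; case: (odd k).
by move/divnK <-; rewrite mulnC leq_mul2l.
Qed.

Lemma few_nonadj_signless : radius 1 (Lgraph n k) <= radius 1 G :> R ->
  (k ^ 2 + 2 * k + 3 <= n)%N ->
  (pairs (nonadj (@adj G)) setT setT + 3 <= 2 * ((k + 1) * (n - k - 2)))%N.
Proof.
move=> LG nk2; have [H [a [Hn aH]]] := clique.
have kn : (k < n)%N by lia.
have lL := lt_le_trans (@radius_Lgraph_signless R _ a H n k erefl Hn kn aH k_ge1) LG.
have G0 : (0 < #|G|)%N by rewrite -/n; lia.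
have [x xu xE] := @radius_eigenfun R 1 G G0.
have [u [d0]] := signless_radius_vertex xu xE lL.
have [s [Es t1 t2 dn]] := edges_through_vertex (@adj_sym G) (@adj_irr G) u.
by move=> h; apply: nonadj_bound_signless edges_nonadj nk d0 Es t1 t2 dn h nk2.
Qed.

End FewNonadjacent.

(** * Comparison of the form of G with that of the hub graph *)

Section Comparison.
Local Open Scope ring_scope.
Variables (R : realType) (T : finType) (b : R) (x : T -> R).
Hypotheses (b_ge0 : 0 <= b) (x_ge0 : forall u, 0 <= x u).

(** The contribution of an edge to the form; it is nonnegative and increases with the values of [x]
    at its ends. *)
Let w u v := 2 * (x u * x v) + b * (x u ^+ 2 + x v ^+ 2).

Let w_ge0 u v : 0 <= w u v.
Proof. by rewrite addr_ge0 ?mulr_ge0 ?addr_ge0 ?sqr_ge0. Qed.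

Lemma qform_sym (r : rel T) : symmetric r ->
  2 * qform r b x = \sum_u \sum_v (r u v)%:R * w u v.
Proof.
move=> rsym; have E : qform r b x = \sum_u \sum_v (r u v)%:R * (x u * x v + b * x u ^+ 2).
  by apply: eq_bigr => u _; rewrite mulr_sumr; apply: eq_bigr => v _; ring.
rewrite mulr_natl mulr2n {2}E exchange_big /= E -big_split; apply: eq_bigr => u _ /=.
by rewrite -big_split; apply: eq_bigr => v _ /=; rewrite rsym /w; ring.
Qed.

Lemma sum_sides (H : {set T}) (F : T -> T -> R) : (forall u v, F u v = F v u) ->
  \sum_u \sum_v F u v = \sum_(u in H) \sum_(v in H) F u v +
    \sum_(u in ~: H) \sum_(v in ~: H) F u v + 2 * \sum_(u in ~: H) \sum_(v in H) F u v.
Proof.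
move=> Fsym.
have split1 (f : T -> R) : \sum_u f u = \sum_(u in H) f u + \sum_(u in ~: H) f u.
  rewrite (bigID (mem H)) /=; congr (_ + _).
  by apply: eq_bigl => u; rewrite inE.
rewrite split1 (eq_bigr _ (fun u _ => split1 (F u))) [X in _ + X](eq_bigr _ (fun u _ => split1 (F u))).
rewrite !big_split /= [\sum_(u in H) \sum_(v in ~: H) _]exchange_big /=.
rewrite [\sum_(j in ~: H) \sum_(i in H) F i j](eq_bigr (fun u => \sum_(v in H) F u v)); last first.
  by move=> u _; apply: eq_bigr => v _; rewrite Fsym.
ring.
Qed.

Lemma sum_eq_termwise (I : finType) (P : pred I) (F F' : I -> R) :
  (forall i, P i -> F i <= F' i) -> \sum_(i | P i) F i = \sum_(i | P i) F' i ->
  forall i, P i -> F i = F' i.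
Proof.
move=> le E i Pi; apply/eqP; rewrite eq_sym -subr_eq0; apply/eqP.
have : \sum_(i | P i) (F' i - F i) = 0 by rewrite sumrB E subrr.
by move/psumr_eq0P; apply => // j /le; rewrite subr_ge0.
Qed.

Variables (e : rel T) (H : {set T}) (a : T).
Hypotheses (esym : symmetric e) (eirr : irreflexive e) (aH : a \in H).
Hypothesis amax : forall v, v \in H -> x v <= x a.
Hypothesis one_nbr : forall s, s \notin H -> (deg_in e H s <= 1)%N.

Let hsym : symmetric (hub_adj a H).
Proof.
by move=> u v; rewrite /hub_adj eq_sym [(u \in H) == _]eq_sym; congr (_ && _); rewrite orbCA.
Qed.

Let cross_hub s : s \notin H ->
  \sum_(v in H) (hub_adj a H s v)%:R * w s v = w s a.
Proof.
move=> sH; have sa : s != a by apply: contraNneq sH => ->.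
rewrite (big_setD1 a) //= /hub_adj sa eqxx orbT mul1r big1 ?addr0 // => v.
by rewrite !inE => /andP[/negPf va vH]; rewrite (negPf sa) va vH (negPf sH) andbF mul0r.
Qed.

Let cross_adj s : s \notin H -> (\sum_(v in H) (e s v)%:R * w s v = 0) \/
  exists v, [/\ v \in H, e s v & \sum_(v in H) (e s v)%:R * w s v = w s v].
Proof.
move=> sH; have [/existsP[v /andP[vH sv]]|no] := boolP [exists v, (v \in H) && e s v].
  right; exists v; split=> //; rewrite (big_setD1 v) //= sv mul1r big1 ?addr0 // => y.
  rewrite !inE => /andP[yv yH]; suff /negPf -> : ~~ e s y by rewrite mul0r.
  apply/negP => sy; have := one_nbr sH; rewrite leqNgt => /negP; apply.
  by apply/card_gt1P; exists y, v; rewrite !inE yH vH sy sv.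
left; rewrite big1 // => v vH; suff /negPf -> : ~~ e s v by rewrite mul0r.
by apply: contraNN no => sv; apply/existsP; exists v; rewrite vH.
Qed.

Let w_mono s v : v \in H -> w s v <= w s a.
Proof.
move=> /amax va; rewrite /w lerD // ?ler_wpM2l //.
by rewrite lerD2l ler_sqr ?nnegrE.
Qed.

Let cross_le s : s \in ~: H -> \sum_(v in H) (e s v)%:R * w s v <=
  \sum_(v in H) (hub_adj a H s v)%:R * w s v.
Proof.
rewrite inE => sH; rewrite cross_hub //.
by have [->|[v [vH _ ->]]] := cross_adj sH; [exact: w_ge0|exact: w_mono].
Qed.

Let side_le u v : (u \in H) = (v \in H) ->
  (e u v)%:R * w u v <= (hub_adj a H u v)%:R * w u v.
Proof.
move=> uv; rewrite ler_wpM2r // ler_nat /hub_adj uv eqxx !orbT andbT.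
by have [->|_] := eqVneq u v; [rewrite eirr|case: (e u v)].
Qed.

Let parts (r : rel T) : symmetric r -> 2 * qform r b x =
  \sum_(u in H) \sum_(v in H) (r u v)%:R * w u v +
  \sum_(u in ~: H) \sum_(v in ~: H) (r u v)%:R * w u v +
  2 * \sum_(u in ~: H) \sum_(v in H) (r u v)%:R * w u v.
Proof.
move=> rsym; rewrite qform_sym // (sum_sides H) // => u v.
by rewrite rsym /w; congr (_ * _); ring.
Qed.

Let leHH u : u \in H -> \sum_(v in H) (e u v)%:R * w u v <=
  \sum_(v in H) (hub_adj a H u v)%:R * w u v.
Proof. by move=> uH; apply: ler_sum => v vH; rewrite side_le ?uH ?vH. Qed.

Let leSS u : u \in ~: H -> \sum_(v in ~: H) (e u v)%:R * w u v <=
  \sum_(v in ~: H) (hub_adj a H u v)%:R * w u v.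
Proof.
rewrite inE => /negPf uH; apply: ler_sum => v; rewrite inE => /negPf vH.
by rewrite side_le // uH vH.
Qed.

(** On each side the hub graph has every possible edge. Across, an outer [s] has at most one
    neighbour [v] in [H], and moving that edge to [a] does not lower its weight since x_v <= x_a. *)
Lemma qform_le_hub : qform e b x <= qform (hub_adj a H) b x.
Proof.
rewrite -(ler_pM2l (ltr0n R 2)) !parts //.
by rewrite !lerD ?ler_sum // ler_wpM2l ?ler_sum.
Qed.

(** Equality holds term by term, and weights are now positive, so no edge is missing. Across, the
    neighbour may differ from [a] if [x] takes equal values there, so only its existence follows. *)
Lemma qform_eq_hub : qform e b x = qform (hub_adj a H) b x ->
  (forall u, 0 < x u) ->
  (forall u v, u != v -> (u \in H) = (v \in H) -> e u v) /\
  (forall s, s \notin H -> exists2 v, v \in H & e s v).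
Proof.
move=> E xp; have w_gt0 u v : 0 < w u v.
  by rewrite ltr_pwDl ?mulr_gt0 // mulr_ge0 ?addr_ge0 ?sqr_ge0.
have HH := ler_sum (index_enum T) leHH; have SS := ler_sum (index_enum T) leSS.
have SH := ler_sum (index_enum T) cross_le.
have := congr1 ( *%R 2) E; rewrite !parts // => E2.
have EH : \sum_(u in H) \sum_(v in H) (e u v)%:R * w u v =
  \sum_(u in H) \sum_(v in H) (hub_adj a H u v)%:R * w u v by lra.
have ES : \sum_(u in ~: H) \sum_(v in ~: H) (e u v)%:R * w u v =
  \sum_(u in ~: H) \sum_(v in ~: H) (hub_adj a H u v)%:R * w u v by lra.
have EC : \sum_(u in ~: H) \sum_(v in H) (e u v)%:R * w u v =
  \sum_(u in ~: H) \sum_(v in H) (hub_adj a H u v)%:R * w u v by lra.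
split.
  move=> u v uv uvH.
  have : (e u v)%:R * w u v = (hub_adj a H u v)%:R * w u v.
    have [uH|uH] := boolP (u \in H).
      have h := sum_eq_termwise leHH EH uH.
      apply: (sum_eq_termwise _ h) => [y yH|]; last by rewrite -uvH.
      by rewrite side_le // uH yH.
    have uC : u \in ~: H by rewrite inE.
    have h := sum_eq_termwise leSS ES uC.
    apply: (sum_eq_termwise _ h) => [y|]; last by rewrite inE -uvH.
    by rewrite inE => /negPf yH; rewrite side_le // (negPf uH) yH.
  move/(mulIf (lt0r_neq0 (w_gt0 u v))); rewrite /hub_adj uv uvH eqxx !orbT /=.
  by case: (e u v) => // /eqP; rewrite eq_sym oner_eq0.
move=> s sH; have sC : s \in ~: H by rewrite inE.
have := sum_eq_termwise cross_le EC sC; rewrite cross_hub //.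
have [->|[v [vH sv _]] _] := cross_adj sH; last by exists v.
by move/eqP; rewrite lt_eqF.
Qed.

End Comparison.

Section HubPositive.
Local Open Scope ring_scope.
Variables (R : realType) (T : finType) (b l : R) (x : T -> R) (a : T) (H : {set T}).

(** A zero of a nonnegative eigenfunction spreads to all neighbours, so through the hub [a] to every
    vertex. *)
Lemma hub_eigenfun_gt0 : (forall u, 0 <= x u) -> (exists u, x u != 0) ->
  (forall u, qop (hub_adj a H) b x u = l * x u) -> forall u, 0 < x u.
Proof.
move=> x0 [u1 xu1] xE.
have nbr u v : x u = 0 -> hub_adj a H u v -> x v = 0.
  move=> xu uv; have := xE u; rewrite /qop xu !mulr0.
  under eq_bigr => y _ do rewrite addr0.
  move/psumr_eq0P => h; have := h (fun y _ => mulr_ge0 (ler0n _ _) (x0 y)) v isT.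
  by rewrite uv mul1r.
have xa : x a != 0.
  apply: contraNneq xu1 => xa; have [->|ua] := eqVneq u1 a; first exact/eqP.
  by apply/eqP/(nbr a) => //; rewrite /hub_adj eq_sym ua eqxx.
move=> u; rewrite lt_def x0 andbT; apply: contraNneq xa => xu.
have [<-|ua] := eqVneq u a; first exact/eqP.
by apply/eqP/(nbr u) => //; rewrite /hub_adj ua eqxx orbT.
Qed.

End HubPositive.

(** * Cycles in a pair of cliques, and the conclusion *)

Section TwoCliques.
Variables (T : finType) (e : rel T) (H : {set T}).
Hypotheses (esym : symmetric e) (eirr : irreflexive e).
Hypothesis cliques : forall u v, u != v -> (u \in H) = (v \in H) -> e u v.

(** For l >= 4 the cycle runs s, t, c, then l - 4 further vertices of [H], then d. A triangle is
    found inside [H]. *)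
Lemma clique_pair_cycles s t c d l : s \notin H -> t \notin H -> s != t ->
  c \in H -> d \in H -> c != d -> e t c -> e s d ->
  3 <= l <= #|H| + 1 -> 2 < #|H| -> exists2 p, ucycle e p & size p = l.
Proof.
move=> sH tH st cH dH cd tc sd ll H3.
have eH : {in H &, forall x y, x != y -> e x y}.
  by move=> x y xH yH xy; apply: cliques => //; rewrite xH yH.
have [l3|l3] := leqP l 3.
  have [B BH B3] := subset_of_card H3.
  exists (enum B); last by rewrite -cardE; lia.
  rewrite /ucycle enum_uniq andbT; apply: complete_cycle; rewrite -?cardE ?enum_uniq ?B3 //.
  by move=> x y; rewrite !mem_enum => /(subsetP BH) xB /(subsetP BH) yB; apply: eH.
have [B BH B3] : exists2 B : {set T}, B \subset H :\ c :\ d & #|B| = l - 4.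
  apply: subset_of_card; have := cardsD1 c H; have := cardsD1 d (H :\ c).
  by rewrite !inE eq_sym cd cH dH /=; lia.
have BHcd x : x \in B -> [/\ x \in H, x != c & x != d].
  by move/(subsetP BH); rewrite !inE => /and3P[].
have uq : uniq (c :: rcons (enum B) d).
  rewrite /= mem_rcons inE (negPf cd) mem_enum rcons_uniq mem_enum enum_uniq andbT.
  apply/andP; split; apply/negP => /BHcd[]; by rewrite eqxx.
have qH x : x \in c :: rcons (enum B) d -> x \in H.
  by rewrite inE mem_rcons inE mem_enum => /or3P[/eqP->|/eqP->|/BHcd[]].
have cq : cycle e (c :: rcons (enum B) d).
  apply: complete_cycle => //=; first by rewrite size_rcons.
  by move=> x y xq yq; apply: eH; apply: qH.
exists (s :: t :: c :: rcons (enum B) d); last by rewrite /= size_rcons -cardE; lia.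
have notq y : y \notin H -> y \notin c :: rcons (enum B) d by apply/contraNN/qH.
rewrite /ucycle cons_uniq inE negb_or st notq // cons_uniq notq // uq !andbT /=.
move: cq => /=; rewrite rcons_path => /andP[pq _].
rewrite tc rcons_path pq last_rcons [e d s]esym sd /= andbT.
by apply: cliques => //; rewrite (negPf sH) (negPf tH).
Qed.

End TwoCliques.

Section SplitGraphs.
Local Open Scope ring_scope.

Lemma unique_nbr (T : finType) (e : rel T) (H : {set T}) s u v :
  (deg_in e H s <= 1)%N -> u \in H -> v \in H -> e s u -> e s v -> u = v.
Proof.
move=> d1 uH vH su sv; apply/eqP; apply: contraTT d1 => uv; rewrite -ltnNge.
by apply/card_gt1P; exists u, v; rewrite !inE uH vH su sv.
Qed.

Lemma hub_adj_iso (G : sgraph) (a : G) (H : {set G}) n k : #|G| = n ->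
  #|H| = (n - k)%N -> (k < n)%N -> a \in H -> @adj G =2 hub_adj a H ->
  sgraph_iso G (Lgraph n k).
Proof.
move=> Gn Hn kn aH hub; have [g [f gK fK] gm] := hub_graph_bij Gn Hn kn aH.
by exists f; [exists g|move=> u v; rewrite -gm !fK hub].
Qed.

Lemma split_cycles_or_iso (R : realType) (b : R) (k : nat) (G : sgraph)
    (H : {set G}) : 0 <= b -> (0 < k)%N -> (k + 3 <= #|G|)%N ->
    radius b (Lgraph #|G| k) <= radius b G ->
    #|H| = (#|G| - k)%N -> (forall s, s \notin H -> (deg_in (@adj G) H s <= 1)%N) ->
  (forall l, (3 <= l <= #|G| - k + 1)%N -> has_cycle G l) \/
  sgraph_iso G (Lgraph #|G| k).
Proof.
move=> b0 k0 kG LG Hn one.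
have kn : (k < #|G|)%N by lia.
have G0 : (0 < #|G|)%N by lia.
have H3 : (2 < #|H|)%N by rewrite Hn; lia.
have [x [u1 xu1] xE] := @radius_eigenfun R b G G0.
pose y u := `|x u|; have y_ge0 u : 0 <= y u by apply: normr_ge0.
have yn : \sum_u y u ^+ 2 = \sum_u x u ^+ 2.
  by apply: eq_bigr => u _; rewrite /y real_normK ?num_real.
(* Taking absolute values keeps the degree terms and does not lower the products x_u x_v. *)
have yG : radius b G * \sum_u y u ^+ 2 <= qform (@adj G) b y.
  rewrite yn mulr_sumr; apply: ler_sum => u _.
  rewrite expr2 mulrCA -xE /qop !mulr_sumr; apply: ler_sum => v _.
  rewrite mulrCA [leRHS]mulrCA ler_wpM2l // !mulrDr lerD //.
    by rewrite -normrM ler_norm.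
  by rewrite mulrCA [leRHS]mulrCA -!expr2 /y real_normK ?num_real.
have /card_gt0P[h0 h0H] : (0 < #|H|)%N by rewrite Hn; lia.
have [a aH amax] : exists2 a, a \in H & forall v, v \in H -> y v <= y a.
  have [a aH amax] := Order.TotalTheory.arg_maxP (P := mem H) y h0H.
  by exists a.
have le1 := qform_le_hub b0 y_ge0 (@adj_sym G) (@adj_irr G) aH amax one.
have le2 := hub_form_le erefl Hn kn aH b y.
have y2 : 0 <= \sum_u y u ^+ 2 by apply: sumr_ge0 => u _; apply: sqr_ge0.
have le3 := ler_wpM2r y2 LG.
(* The inequalities [yG], [le1], [le2] and [le3] form a closed chain, so all are equalities. *)
have eqL : qform (hub_adj a H) b y = radius b (Lgraph #|G| k) * \sum_u y u ^+ 2 by lra.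
have eqG : qform (@adj G) b y = qform (hub_adj a H) b y by lra.
have y_gt0 : forall u, 0 < y u.
  apply: hub_eigenfun_gt0 y_ge0 _ (hub_form_eq erefl Hn kn aH eqL).
  by exists u1; rewrite normr_eq0.
have [cl ex1] := qform_eq_hub b0 y_ge0 (@adj_sym G) (@adj_irr G) aH amax one eqG y_gt0.
have /card_gt0P[s] : (0 < #|~: H|)%N by have := cardsC H; lia.
rewrite inE => sH; have [d dH sd] := ex1 s sH.
(* If all outer vertices are attached to [d], then [d], possibly different from [a], is the hub of
   L_{n,k}. *)
have [/forall_inP alld|] := boolP [forall t in ~: H, adj t d].
  right; apply: (hub_adj_iso erefl Hn kn dH).
  have cross u v : u \in H -> v \notin H -> adj u v = hub_adj d H u v.
    move=> uH vH; have vd : adj v d by apply: alld; rewrite inE.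
    have uv : u != v by apply: contraNneq vH => <-.
    have vd' : v != d by apply: contraNneq vH => ->.
    rewrite /hub_adj uv uH (negPf vH) (negPf vd') !orbF adj_sym.
    have [->|ud] := eqVneq u d; first exact: vd.
    by apply: contraNF ud => vu; apply/eqP/(unique_nbr (one v vH)).
  move=> u v; have [<-|uv] := eqVneq u v; first by rewrite adj_irr /hub_adj eqxx.
  have [uH|uH] := boolP (u \in H); have [vH|vH] := boolP (v \in H).
  - by rewrite cl ?uH ?vH // /hub_adj uv uH vH !orbT.
  - exact: cross.
  - rewrite adj_sym cross // /hub_adj eq_sym (negPf uH) vH.
    by rewrite orbCA.
  - by rewrite cl ?(negPf uH) ?(negPf vH) // /hub_adj uv (negPf uH) (negPf vH) !orbT.
rewrite negb_forall_in => /exists_inP[t]; rewrite inE => tH td.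
left=> l ll; have [c cH tc] := ex1 t tH.
have cd : c != d by apply: contraNneq td => <-.
have st : s != t by apply: contraNneq td => <-.
apply: (clique_pair_cycles (@adj_sym G) cl sH tH st cH dH cd tc sd).
  by rewrite Hn.
exact: H3.
Qed.

End SplitGraphs.

Theorem theorem1p7 (R : realType) (k n : nat) (G : sgraph)
    (k_ge1 : 1 <= k) (order_G : #|G| = n)
    (hyp :
      ((spectral_radius R (Lgraph n k) <= spectral_radius R G)%R /\
         maxn (6 * k + 11) ((k + 3) * (k + 4) %/ 2) <= n) \/
      ((signless_spectral_radius R (Lgraph n k)
          <= signless_spectral_radius R G)%R /\
         maxn (6 * k + 11) (k ^ 2 + 2 * k + 3) <= n)) :
  (forall l : nat, 3 <= l <= n - k + 1 -> has_cycle G l) \/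
  sgraph_iso G (Lgraph n k).
Proof.
subst n.
(* Both hypotheses lead to the same data; from here on they differ only in the value of [b]. *)
have [b [b0 LG few nk]] : exists b : R, [/\ (0 <= b)%R,
    (radius b (Lgraph #|G| k) <= radius b G)%R,
    pairs (nonadj (@adj G)) setT setT + 3 <= 2 * ((k + 1) * (#|G| - k - 2))
    & 6 * k + 11 <= #|G|].
  case: hyp => -[].
    rewrite !spectral_radiusE geq_max => LG /andP[nk nk2].
    by exists 0%R; split=> //; apply: few_nonadj_adjacency LG nk2.
  rewrite !signless_spectral_radiusE geq_max => LG /andP[nk nk2].
  by exists 1%R; split=> //; apply: few_nonadj_signless LG nk2.
have [cyc|[H Hn one]] := dense_cycles_or_split (@adj_sym G) (@adj_irr G) erefl k_ge1 nk few.
  by left.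
by apply: split_cycles_or_iso b0 _ _ LG Hn one => //; lia.
Qed.
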